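(* Let $\alpha\in\mathbb{F}_q((z^{-1}))$ be irrational. There exists $\varepsilon>0$ such that $\mathrm{Bad}^{\varepsilon}(\alpha)$ has Hausdorff dimension $1$ if and only if $\alpha$ is singular on average.
   Context: Let $q$ be a prime power, $\mathbb{F}_q[z]$ the polynomial ring over $\mathbb{F}_q$, $\mathbb{F}_q((z^{-1}))$ the field of formal Laurent series $x=\sum_{i\ge-N}a_iz^{-i}$, with $\|x\|=q^{\deg x}$ for $x\ne0$ and $\|0\|=0$; $\alpha$ is irrational if $\alpha\notin\mathbb{F}_q(z)$. The fractional part is $\{x\}=\sum_{i\ge1}a_iz^{-i}$, and $|\langle x\rangle|=\min_{y\in\mathbb{F}_q[z]}\|x-y\|$. $\mathbb{I}=\{x:\|x\|<1\}$. For $\varepsilon>0$, $\mathrm{Bad}^{\varepsilon}(\alpha)=\{\theta\in\mathbb{I}:\liminf_{Q\in\mathbb{F}_q[z],\|Q\|\to\infty}\|Q\|\,|\langle Q\alpha-\theta\rangle|\ge\varepsilon\}$; Hausdorff dimension is with respect to the metric $\|x-y\|$. For $c>0$ and $N\ge1$, $\Delta_{N,c}(\alpha)$ is the number of integers $l\in\{1,\dots,N\}$ for which the inequality $\|\{Q\alpha\}\|\le c2^{-l}$ has a solution $Q\in\mathbb{F}_q[z]$ with $0<\|Q\|\le 2^l$. $\alpha$ is called singular on average if $\lim_{N\to\infty}\Delta_{N,c}(\alpha)/N=1$ for every $c>0$. *)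

(* Defs.v *)
From HB Require Import structures.
From mathcomp Require Import all_boot all_order all_algebra.
From mathcomp Require Import all_classical all_reals all_analysis.
From mathcomp Require Import zify ring lra.

Set Implicit Arguments.
Unset Strict Implicit.
Unset Printing Implicit Defensive.

Import Order.TTheory GRing.Theory Num.Theory.
Import numFieldNormedType.Exports.

Local Open Scope classical_set_scope.
Local Open Scope ring_scope.

(* Formal Laurent series in z^-1: [x i] is the coefficient of z^i. *)
Record laurent (F : fieldType) := Laurent {
  lcoef :> int -> F;
  lcoef_bounded : exists N : int, forall i, N < i -> lcoef i = 0 }.

HB.instance Definition _ (F : fieldType) := gen_eqMixin (laurent F).
HB.instance Definition _ (F : fieldType) := gen_choiceMixin (laurent F).

Lemma laurentP (F : fieldType) (x y : laurent F) : (forall i, x i = y i) -> x = y.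
Proof.
case: x y => [x xb] [y yb] /= /funext xy; subst y.
by rewrite (Prop_irrelevance xb yb).
Qed.

Lemma finite_int_interval (a b : int) : finite_set [set i : int | a <= i <= b].
Proof.
apply: (@sub_finite_set _ _ ((fun k : nat => a + k%:Z) @` `I_(`|b - a|.+1)%N)).
  move=> i /= /andP[ai ib]; exists `|i - a|%N => /=; lia.
by apply: finite_image; exact: finite_II.
Qed.

Section laurent_ring.
Variable F : fieldType.
Implicit Types x y t : laurent F.

Lemma lzero_subproof : exists N : int, forall i, N < i -> (fun=> 0 : F) i = 0.
Proof. by exists 0. Qed.
Definition lzero := Laurent lzero_subproof.

Lemma lone_subproof :
  exists N : int, forall i, N < i -> (fun i => (i == 0)%:R : F) i = 0.
Proof. by exists 0 => i i0 /=; rewrite gt_eqF. Qed.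
Definition lone := Laurent lone_subproof.

Lemma lopp_subproof x : exists N : int, forall i, N < i -> (fun i => - x i) i = 0.
Proof. by case: (lcoef_bounded x) => N xN; exists N => i /xN ->; rewrite oppr0. Qed.
Definition lopp x := Laurent (lopp_subproof x).

Lemma ladd_subproof x y :
  exists N : int, forall i, N < i -> (fun i => x i + y i) i = 0.
Proof.
have [[M xM] [N yN]] := (lcoef_bounded x, lcoef_bounded y).
exists (Num.max M N) => i; rewrite gt_max => /andP[/xM -> /yN ->].
exact: addr0.
Qed.
Definition ladd x y := Laurent (ladd_subproof x y).

(* On bounded-above x and y only finitely many terms are nonzero, so this is
   not the default value 0 of an infinitely supported sum. *)
Definition lmul_coef (x y : int -> F) (n : int) : F :=
  \sum_(i \in [set: int]) x i * y (n - i).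

Lemma lmul_subproof x y :
  exists N : int, forall i, N < i -> lmul_coef x y i = 0.
Proof.
have [[M xM] [N yN]] := (lcoef_bounded x, lcoef_bounded y).
exists (M + N) => n nMN; apply: fsbig1 => i _.
have [iM|Mi] := leP i M; last by rewrite xM ?mul0r.
by rewrite yN ?mulr0//; lia.
Qed.
Definition lmul x y := Laurent (lmul_subproof x y).

Lemma lmul_coefE (x y : int -> F) (M N a b n : int) :
    (forall i, M < i -> x i = 0) -> (forall i, N < i -> y i = 0) ->
    a <= n - N -> M <= b ->
  lmul_coef x y n = \sum_(i \in [set i | a <= i <= b]) x i * y (n - i).
Proof.
move=> xM yN an Mb; apply/esym/fsbig_widen => // i [_ /= /negP].
rewrite negb_and -!ltNge => /orP[ia|bi].
  by rewrite /preimage/= yN ?mulr0//; lia.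
by rewrite /preimage/= xM ?mul0r//; lia.
Qed.

Lemma laddA : associative ladd.
Proof. by move=> x y t; apply: laurentP => i /=; rewrite addrA. Qed.
Lemma laddC : commutative ladd.
Proof. by move=> x y; apply: laurentP => i /=; rewrite addrC. Qed.
Lemma ladd0 : left_id lzero ladd.
Proof. by move=> x; apply: laurentP => i /=; rewrite add0r. Qed.
Lemma laddN : left_inverse lzero lopp ladd.
Proof. by move=> x; apply: laurentP => i /=; rewrite addNr. Qed.

HB.instance Definition _ :=
  GRing.isZmodule.Build (laurent F) laddA laddC ladd0 laddN.

Lemma lmulC : commutative lmul.
Proof.
move=> x y; apply: laurentP => n /=.
rewrite /lmul_coef (reindex_fsbigT (fun i : int => n - i)); last first.
  by exists (fun i : int => n - i) => i /=; lia.
by apply: eq_fsbigr => i _; rewrite mulrC; congr (y _ * x _); lia.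
Qed.

Lemma lmul1 : left_id lone lmul.
Proof.
move=> x; apply: laurentP => n /=; rewrite /lmul_coef.
rewrite -(fsbig_widen [set (0 : int)]) //; last first.
  by move=> i [_ /= /eqP/negPf i0]; rewrite /preimage/= i0 mul0r.
by rewrite fsbig_set1 eqxx mul1r subr0.
Qed.

Lemma lmulDl : left_distributive lmul ladd.
Proof.
move=> x y t; apply: laurentP => n /=.
have [[[M xM] [N yN]] [P tP]] :=
  (lcoef_bounded x, lcoef_bounded y, lcoef_bounded t).
pose b := Num.max M N.
have Mb : M <= b by rewrite le_max lexx.
have Nb : N <= b by rewrite le_max lexx orbT.
rewrite (@lmul_coefE x t M P (n - P) b)// (@lmul_coefE y t N P (n - P) b)//.
rewrite (@lmul_coefE _ t b P (n - P) b)//; last first.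
  by move=> i bi; rewrite xM ?yN ?addr0//; lia.
rewrite -fsbig_split; last exact: finite_int_interval.
by apply: eq_fsbigr => i _ /=; rewrite mulrDl.
Qed.

Lemma lmulA : associative lmul.
Proof.
move=> x y t; apply: laurentP => n /=.
have [[[M xM] [N yN]] [P tP]] :=
  (lcoef_bounded x, lcoef_bounded y, lcoef_bounded t).
have bmul (u v : int -> F) (K L : int) : (forall i, K < i -> u i = 0) ->
    (forall i, L < i -> v i = 0) ->
    forall i, K + L < i -> lmul_coef u v i = 0.
  move=> uK vL i KLi; apply: fsbig1 => j _.
  have [jK|Kj] := leP j K; last by rewrite uK ?mul0r.
  by rewrite vL ?mulr0//; lia.
pose A := [set i : int | n - P <= i <= M + N].
pose B := [set j : int | n - N - P <= j <= M].
rewrite [RHS](@lmul_coefE _ _ (M + N) P (n - P) (M + N)) //; last exact: bmul.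
rewrite [LHS](@lmul_coefE _ _ M (N + P) (n - N - P) M) //; [|exact: bmul|lia].
transitivity (\sum_(j \in B) \sum_(i \in A) x j * (y (i - j) * t (n - i))).
  apply: eq_fsbigr => j; rewrite inE => /andP[j1 j2].
  rewrite -mulr_fsumr; congr (_ * _); rewrite /lmul_coef.
  rewrite (reindex_fsbigT (fun i : int => i - j)); last first.
    by exists (fun i : int => i + j) => i /=; lia.
  rewrite (eq_fsbigr (fun i => y (i - j) * t (n - i))); last first.
    by move=> i _; congr (_ * t _); lia.
  apply/esym/fsbig_widen => // i [_ /= /negP].
  rewrite negb_and -!ltNge /preimage/= => /orP[ia|bi].
    by rewrite tP ?mulr0//; lia.
  by rewrite yN ?mul0r//; lia.
rewrite exchange_fsbig; [|exact: finite_int_interval|exact: finite_int_interval].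
apply: eq_fsbigr => i; rewrite inE => /andP[i1 i2].
rewrite (eq_fsbigr (fun j => x j * y (i - j) * t (n - i))); last first.
  by move=> j _; rewrite mulrA.
rewrite -mulr_fsuml; congr (_ * _); apply/esym.
by apply: (@lmul_coefE _ _ M N) => //; lia.
Qed.

Lemma lone_neq0 : lone != 0 :> laurent F.
Proof.
apply/eqP => /(congr1 (fun x : laurent F => x 0)) /= /eqP.
by rewrite oner_eq0.
Qed.

HB.instance Definition _ := GRing.Zmodule_isComNzRing.Build (laurent F)
  lmulA lmulC lmul1 lmulDl lone_neq0.

Lemma lcoef0 i : (0 : laurent F) i = 0. Proof. by []. Qed.
Lemma lcoef1 i : (1 : laurent F) i = (i == 0)%:R. Proof. by []. Qed.
Lemma lcoefD x y i : (x + y) i = x i + y i. Proof. by []. Qed.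
Lemma lcoefN x i : (- x) i = - x i. Proof. by []. Qed.
Lemma lcoefB x y i : (x - y) i = x i - y i. Proof. by []. Qed.
Lemma lcoefM x y n : (x * y) n = \sum_(i \in [set: int]) x i * y (n - i).
Proof. by []. Qed.

(* The degree of x, meaningful for x != 0 only. *)
Definition is_ldeg x (d : int) := x d != 0 /\ forall i, d < i -> x i = 0.
Definition ldeg x : int := xget 0 [set d | is_ldeg x d].

Lemma ldeg_exists x : x != 0 -> exists d, is_ldeg x d.
Proof.
move=> x0; have [j xj] : exists j, x j != 0.
  apply: contrapT => /forallNP nx; move/eqP: x0; apply; apply: laurentP => i.
  by apply/eqP; apply: contrapT => /negP /nx.
have [N xN] := lcoef_bounded x.
have jN : j <= N by rewrite leNgt; apply: contra xj => /xN ->.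
have ex : exists k : nat, x (N - k%:Z) != 0.
  by exists `|N - j|%N; rewrite (_ : N - _ = j)//; lia.
case: (ex_minnP ex) => k xk kmin; exists (N - k%:Z); split => // i ki.
apply/eqP; apply: contraT => xi.
have iN : i <= N by rewrite leNgt; apply: contra xi => /xN ->.
have := kmin `|N - i|%N; rewrite (_ : N - _ = i); last by lia.
by move=> /(_ xi); lia.
Qed.

Lemma ldegP x : x != 0 -> is_ldeg x (ldeg x).
Proof. by move=> /ldeg_exists; exact: xgetPex. Qed.

(* The first n coefficients of the inverse of the power series with
   coefficients c, latest first. *)
Fixpoint invps (c : nat -> F) (n : nat) : seq F :=
  if n is n'.+1 then
    let s := invps c n' in
    (c 0%N)^-1 * ((n' == 0%N)%:R - \sum_(i < n') c i.+1 * s`_i) :: s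
  else [::].

Lemma size_invps c n : size (invps c n) = n.
Proof. by elim: n => //= n ->. Qed.

Lemma nth_invps c n i : (i < n)%N -> (invps c n)`_i = (invps c (n - i))`_0.
Proof.
elim: n i => // n IHn [|i]; first by rewrite subn0.
by rewrite ltnS => /IHn; rewrite subSS.
Qed.

Lemma invpsP c n : c 0%N != 0 ->
  \sum_(i < n.+1) c i * (invps c (n - i).+1)`_0 = (n == 0%N)%:R.
Proof.
move=> c0; rewrite big_ord_recl subn0 [X in c 0%N * X]/= mulrA mulfV// mul1r.
rewrite [X in _ + X](eq_bigr (fun i : 'I_n => c i.+1 * (invps c n)`_i)).
  by rewrite subrK.
by move=> i _; rewrite lift0 [in RHS]nth_invps ?ltn_ord// subnSK.
Qed.

Lemma linv_exists x : x != 0 -> exists y, y * x = 1.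
Proof.
move=> /ldegP; move: (ldeg x) => d [xd xgtd].
pose c k := x (d - k%:Z).
have c0 : c 0%N != 0 by rewrite /c subr0.
pose yc (i : int) : F := if - d < i then 0 else (invps c `|(- d - i)%R|.+1)`_0.
have yb : exists N : int, forall i, N < i -> yc i = 0.
  by exists (- d) => i di; rewrite /yc di.
exists (Laurent yb); rewrite mulrC; apply: laurentP => n.
rewrite lcoefM lcoef1 /=.
have [n0|n0] := ltP 0 n.
  rewrite gt_eqF// fsbig1// => i _.
  have [id|di] := leP i d; last by rewrite xgtd ?mul0r.
  by rewrite /yc ifT ?mulr0//; lia.
rewrite (_ : (n == 0)%:R = ((`|n|%N == 0%N)%:R : F)); last by congr (_%:R); lia.
rewrite -(invpsP _ c0).
rewrite (fsbig_ord _ _ (fun k => c k * (invps c (`|n| - k).+1)`_0)).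
rewrite -(fsbig_widen ((fun k : nat => d - k%:Z) @` `I_(`|n|.+1)%N)) //.
  rewrite fsbig_image; last by move=> i j _ _ /=; lia.
  apply: eq_fsbigr => k; rewrite inE => kn; rewrite /= in kn.
  rewrite /yc ifF; last by lia.
  by rewrite (_ : `|_|%N = `|n| - k)%N//; lia.
move=> i [_ /= ni]; rewrite /preimage/=.
have [id|di] := leP i d; last by rewrite xgtd ?mul0r.
have [ni'|ni'] := leP (n + d) i; last by rewrite /yc ifT ?mulr0//; lia.
by case: ni; exists `|d - i|%N; lia.
Qed.

Definition linv x : laurent F :=
  if x == 0 then 0 else xget 0 [set y | y * x = 1].

Lemma linvVf x : x != 0 -> linv x * x = 1.
Proof.
by move=> x0; rewrite /linv (negPf x0); exact: (xgetPex 0 (linv_exists x0)).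
Qed.

Lemma linv0 : linv 0 = 0. Proof. by rewrite /linv eqxx. Qed.

HB.instance Definition _ :=
  GRing.ComNzRing_isField.Build (laurent F) linvVf linv0.

Definition polyL_coef (P : {poly F}) (i : int) : F :=
  if i is Posz n then P`_n else 0.

Lemma polyL_subproof P : exists N : int, forall i, N < i -> polyL_coef P i = 0.
Proof.
by exists (size P)%:Z => -[n|//] /= ?; rewrite nth_default//; lia.
Qed.
Definition polyL (P : {poly F}) : laurent F := Laurent (polyL_subproof P).

Lemma polyL_is_zmod_morphism : zmod_morphism polyL.
Proof.
by move=> P Q; apply: laurentP => -[n|n] /=; rewrite ?coefB// subr0.
Qed.

Lemma polyL_is_monoid_morphism : monoid_morphism polyL.
Proof.
split; first by apply: laurentP => -[n|n] //=; rewrite coef1.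
move=> P Q; apply: laurentP => -[n|n]; rewrite lcoefM /=.
  rewrite coefM (fsbig_ord _ _ (fun k => P`_k * Q`_(n - k))).
  rewrite -(fsbig_widen (Posz @` `I_n.+1)) //.
    rewrite fsbig_image; last by move=> i j _ _ [].
    apply: eq_fsbigr => k; rewrite inE /= => kn.
    by rewrite subzn//; lia.
  move=> [k|k] [_ /= nk]; rewrite /preimage/= ?mul0r//.
  have [kn|kn] := ltnP k n.+1; first by case: nk; exists k.
  by case E: (n%:Z - k%:Z) => [m|m]; rewrite /= ?mulr0//; lia.
rewrite fsbig1// => -[k|k] _ /=; rewrite ?mul0r//.
by case E: (Negz n - k%:Z) => [m|m]; rewrite /= ?mulr0//; lia.
Qed.

HB.instance Definition _ :=
  GRing.isZmodMorphism.Build {poly F} (laurent F) polyL polyL_is_zmod_morphism.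
HB.instance Definition _ :=
  GRing.isMonoidMorphism.Build {poly F} (laurent F) polyL polyL_is_monoid_morphism.

Lemma fracpart_subproof x :
  exists N : int, forall i, N < i -> (fun i => if i < 0 then x i else 0) i = 0.
Proof. by exists 0 => i i0 /=; rewrite ltNge ltW. Qed.
Definition fracpart x : laurent F := Laurent (fracpart_subproof x).

Lemma fracpartB x : exists P, x - fracpart x = polyL P.
Proof.
have [N xN] := lcoef_bounded x.
exists (\poly_(i < `|N|.+1) x i%:Z); apply: laurentP => -[n|n]; rewrite lcoefB /=.
  by rewrite subr0 coef_poly; case: ifPn => // nN; apply: xN; lia.
by rewrite subrr.
Qed.

Definition irrational_laurent x :=
  ~ exists P Q : {poly F}, Q != 0 /\ x = polyL P / polyL Q.

End laurent_ring.

Section laurent_norm.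
Variables (R : realType) (F : finFieldType).
Implicit Types x y : laurent F.

Definition lnorm x : R := if x == 0 then 0 else #|F|%:R ^ ldeg x.

Lemma card_gt1 : 1 < #|F|%:R :> R.
Proof. by rewrite ltr1n; exact: card_finNzRing_gt1. Qed.

Lemma card_gt0 : 0 < #|F|%:R :> R.
Proof. exact: lt_trans card_gt1. Qed.

Lemma lnorm0 : lnorm 0 = 0. Proof. by rewrite /lnorm eqxx. Qed.

Lemma lnorm_ge0 x : 0 <= lnorm x.
Proof. by rewrite /lnorm; case: ifP => // _; exact/exprz_ge0/ltW/card_gt0. Qed.

Lemma lnorm_eq0 x : lnorm x = 0 -> x = 0.
Proof.
by rewrite /lnorm; case: eqP => // _ /eqP; rewrite gt_eqF// exprz_gt0// card_gt0.
Qed.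

Lemma lnorm_le x (k : int) :
  lnorm x <= #|F|%:R ^ k <-> forall i, k < i -> x i = 0.
Proof.
rewrite /lnorm; case: eqVneq => [->|x0].
  by split => // _; exact/exprz_ge0/ltW/card_gt0.
rewrite ler_eXz2l ?card_gt1//; have [xd xgtd] := ldegP x0; split.
  by move=> dk i ki; apply: xgtd; exact: le_lt_trans ki.
move=> xk; rewrite leNgt; apply/negP => kd; move/eqP: xd; apply.
exact: xk.
Qed.

Lemma lnormN x : lnorm (- x) = lnorm x.
Proof.
suff le y : lnorm (- y) <= lnorm y.
  by apply/le_anti; rewrite le -{1}(opprK x) le.
rewrite [leRHS]/lnorm; case: eqVneq => [->|y0]; first by rewrite oppr0 lnorm0.
by apply/lnorm_le => i di; rewrite lcoefN (ldegP y0).2 ?oppr0.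
Qed.

Lemma lnormD x y : lnorm (x + y) <= Num.max (lnorm x) (lnorm y).
Proof.
suff le u v : lnorm u <= lnorm v -> lnorm (u + v) <= lnorm v.
  by have [/le//|/ltW/le] := leP (lnorm x) (lnorm y); rewrite addrC.
move: u v => {}x {}y xy.
have [y0|y0] := eqVneq y 0; first by move: xy; rewrite y0 addr0.
rewrite [lnorm y]/lnorm (negPf y0); apply/lnorm_le => i di.
rewrite lcoefD (ldegP y0).2// addr0.
have : lnorm x <= #|F|%:R ^ ldeg y.
  by apply: le_trans xy _; rewrite /lnorm (negPf y0).
by move/lnorm_le; exact.
Qed.

(* The distance |<x>| of x to F[z]; the infimum is a minimum by [dist_poly_fracpart]. *)
Definition dist_poly x : R :=
  inf [set lnorm (x - polyL P) | P in [set: {poly F}]].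

Lemma dist_poly_fracpart x :
  dist_poly x = lnorm (fracpart x) /\
  exists P : {poly F}, dist_poly x = lnorm (x - polyL P).
Proof.
have [P xP] := fracpartB x.
have Pfrac : x - polyL P = fracpart x by rewrite -xP opprB addrC subrK.
suff -> : dist_poly x = lnorm (fracpart x) by split=> //; exists P; rewrite Pfrac.
have lbf : lbound [set lnorm (x - polyL P) | P in [set: {poly F}]]
    (lnorm (fracpart x)).
  move=> _ [Q _ <-]; rewrite [leRHS]/lnorm; case: eqVneq => [/subr0_eq ->|y0].
    rewrite (_ : fracpart _ = 0) ?lnorm0//.
    by apply: laurentP => -[n|n] /=.
  apply/lnorm_le => i di /=; case: ifPn => // i0.
  rewrite -[RHS]((ldegP y0).2 i di) lcoefB.
  by case: i i0 {di} => //= n _; rewrite subr0.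
apply/le_anti/andP; split; last first.
  by apply: lb_le_inf => //; exists (lnorm (x - polyL P)), P.
by apply: ge_inf; [exists (lnorm (fracpart x))|exists P; rewrite ?Pfrac].
Qed.

End laurent_norm.

(* The alias carries R, on which the metric structure depends. *)
Definition laurent_metric (R : realType) (F : finFieldType) : Type := laurent F.

Section laurent_metric_instance.
Variables (R : realType) (F : finFieldType).

Definition ldist (x y : laurent F) : R := lnorm R (x - y).

Lemma ldistxx x : ldist x x = 0. Proof. by rewrite /ldist subrr lnorm0. Qed.

Lemma ldist_positivity x y : ldist x y = 0 -> x = y.
Proof. by move=> /lnorm_eq0 /subr0_eq. Qed.

Lemma ldist_sym x y : ldist x y = ldist y x.
Proof. by rewrite /ldist -lnormN opprB. Qed.

Lemma ldist_triangle y x t : ldist x t <= ldist x y + ldist y t.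
Proof.
rewrite /ldist -[x - t](subrKA y) (le_trans (lnormD _ _ _))// ge_max.
by rewrite lerDl lerDr !lnorm_ge0.
Qed.

HB.instance Definition _ := Choice.copy (laurent_metric R F) (laurent F).
HB.instance Definition _ := @isMetric.Build R (laurent_metric R F)
  ldist ldistxx ldist_positivity ldist_sym ldist_triangle.

Lemma mdist_lnorm (x y : laurent_metric R F) :
  mdist x y = lnorm R ((x : laurent F) - y) :> R.
Proof. by []. Qed.

End laurent_metric_instance.

Section hausdorff.
Variables (R : realType) (T : metricType R).
Implicit Types A U : set T.
Local Open Scope ereal_scope.

Definition diam U : \bar R := ereal_sup [set (mdist x y)%:E | x in U & y in U].

(* (diam U)^s, with the conventions (diam set0)^s = 0 and 0^0 = 1. *)
Definition diam_pow (s : R) U : \bar R :=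
  if U == set0 then 0 else diam U `^ s.

Definition hausdorff_content (delta s : R) A : \bar R :=
  ereal_inf [set \sum_(0 <= i <oo) diam_pow s (U i) |
    U in [set U : (set T)^nat |
      A `<=` \bigcup_i U i /\ forall i, diam (U i) <= delta%:E]].

Definition hausdorff_measure (s : R) A : \bar R :=
  ereal_sup [set hausdorff_content delta s A | delta in [set d : R | (0 < d)%R]].

Definition hausdorff_dim A : \bar R :=
  ereal_inf [set s%:E | s in [set s : R | (0 <= s)%R /\ hausdorff_measure s A = 0]].

End hausdorff.

Section approximation.
Variables (R : realType) (F : finFieldType).
Implicit Types alpha theta : laurent F.

Definition liminf_poly (f : {poly F} -> \bar R) : \bar R :=
  ereal_sup [set ereal_inf [set f Q | Q in [set Q | M < lnorm R (polyL Q)]] |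
    M in [set: R]].

Definition Bad (eps : R) alpha : set (laurent_metric R F) :=
  [set theta | lnorm R theta < 1 /\
    (eps%:E <= liminf_poly (fun Q =>
      (lnorm R (polyL Q) * dist_poly R (polyL Q * alpha - theta))%:E))%E].

Definition has_solution (c : R) alpha (l : nat) : Prop :=
  exists Q : {poly F}, 0 < lnorm R (polyL Q) <= 2 ^+ l /\
    lnorm R (fracpart (polyL Q * alpha)) <= c / 2 ^+ l.

Definition Delta (N : nat) (c : R) alpha : nat :=
  count (fun l => `[< has_solution c alpha l >]) (iota 1 N).

Definition singular_on_average alpha : Prop :=
  forall c : R, 0 < c -> (Delta N c alpha)%:R / N%:R @[N --> \oo] --> (1 : R).

End approximation.

(* Main.v *)
Require Import Defs.
From mathcomp Require Import all_boot all_order all_algebra.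
From mathcomp Require Import all_classical all_reals all_analysis.
From mathcomp Require Import zify ring lra.

Set Implicit Arguments.
Unset Strict Implicit.
Unset Printing Implicit Defensive.

Import Order.TTheory GRing.Theory Num.Theory.
Import numFieldNormedType.Exports.

Local Open Scope classical_set_scope.
Local Open Scope ring_scope.

(* Let q be the order of F and let S be the set of degrees of the convergents
   of alpha. Both properties of alpha are equivalent to S having density 0.

   Singularity on average: Q alpha is not well approximated at scale 2 ^ l
   exactly when q ^ D is within a bounded factor above 2 ^ l for some D in S.

   S sparse: let R_D be the denominator of degree D. If the coefficient of z^-1
   of R_D theta is nonzero for all D in S, then multiplying Q alpha - theta by
   R_D, with D maximal in S such that D <= deg Q + 1, shows that theta is badly
   approximated. Such a condition involves the digits of theta up to position
   D + 1 and excludes a single value of the last one, so fixing these digits and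
   leaving the others free gives a Cantor set whose cylinders of level n have
   mass q ^ (o(n) - n), hence of dimension 1.

   S not sparse: for D in S the points Q alpha with deg Q < D meet every cylinder
   of level D exactly once, so that theta badly approximated has to avoid, in
   every cylinder of level D, a subcylinder of level D + e. This happens for a
   positive proportion of the levels D, along a sequence of scales. *)

(** * Laurent series vanishing above a degree, and fractional parts *)

Section vanishing.
Variable F : fieldType.
Implicit Types (x y : laurent F) (P Q : {poly F}).

(* Over a finite field of order q this says that the norm of x is at most q ^ k. *)
Definition vanish_above x (k : int) := forall i, k < i -> x i = 0.

Lemma vanish_above_le x (k l : int) :
  k <= l -> vanish_above x k -> vanish_above x l.
Proof. by move=> kl xk i li; apply: xk; exact: le_lt_trans li. Qed.

Lemma vanish_aboveB x y k :
  vanish_above x k -> vanish_above y k -> vanish_above (x - y) k.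
Proof. by move=> xk yk i ki; rewrite lcoefB xk// yk// subr0. Qed.

Lemma vanish_aboveM x y a b :
  vanish_above x a -> vanish_above y b -> vanish_above (x * y) (a + b).
Proof.
move=> xa yb n abn; rewrite lcoefM; apply: fsbig1 => i _.
have [ia|ai] := leP i a; last by rewrite xa ?mul0r.
by rewrite yb ?mulr0//; lia.
Qed.

Lemma lcoefM_top x y a b :
  vanish_above x a -> vanish_above y b -> (x * y) (a + b) = x a * y b.
Proof.
move=> xa yb; rewrite lcoefM -(fsbig_widen [set a]) //.
  by rewrite fsbig_set1; congr (_ * y _); lia.
move=> i [_ /= /eqP ia]; rewrite /preimage/=.
have [ia'|ai] := leP i a; last by rewrite xa ?mul0r.
by rewrite yb ?mulr0//; lia.
Qed.

(** By [lcoefM_top] leading coefficients multiply, so a degree of [y] above [b] would show in the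
    product. *)
Lemma vanish_aboveM_cancel x y a b : x a != 0 -> vanish_above x a ->
  vanish_above (x * y) (a + b) -> vanish_above y b.
Proof.
move=> xa0 xa xyab; have [->//|/ldegP[yd ygtd]] := eqVneq y 0.
have [db|bd] := leP (ldeg y) b; first exact: vanish_above_le ygtd.
have /eqP := lcoefM_top xa ygtd; rewrite xyab; last by lia.
by rewrite eq_sym mulf_eq0 (negPf xa0) (negPf yd).
Qed.

Lemma vanish_polyL Q n : (size Q <= n)%N -> vanish_above (polyL Q) (n%:Z - 1).
Proof.
move=> Qn [i|//] ni /=; rewrite nth_default// (leq_trans Qn)//.
by move: ni; lia.
Qed.

Lemma polyL_eq0 P : vanish_above (polyL P) (-1) -> P = 0.
Proof. by move=> P1; apply/polyP => i; rewrite coef0; exact: (P1 i%:Z). Qed.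

Lemma polyL_lead_neq0 Q : Q != 0 -> polyL Q ((size Q)%:Z - 1) != 0.
Proof.
move=> Q0; have := Q0; rewrite -lead_coef_eq0 /lead_coef.
have : (0 < size Q)%N by rewrite size_poly_gt0.
by case: (size Q) => // n _; rewrite (_ : n.+1%:Z - 1 = n)//; lia.
Qed.

Lemma polyL_neg P n : polyL P (Negz n) = 0. Proof. by []. Qed.

Lemma fracpart_neg x n : fracpart x (Negz n) = x (Negz n). Proof. by []. Qed.

Lemma vanish_fracpart_lt1 x : vanish_above (fracpart x) (-1).
Proof. by move=> [i|i] //; lia. Qed.

Lemma vanish_fracpart x P (k : int) :
  vanish_above (x - polyL P) k -> vanish_above (fracpart x) k.
Proof. by move=> xP [i|i]//= ki; have := xP _ ki; rewrite lcoefB subr0. Qed.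

Lemma vanish_fracpartP x (k : int) :
  vanish_above (fracpart x) k -> exists P, vanish_above (x - polyL P) k.
Proof.
by have [P xP] := fracpartB x; exists P; rewrite -xP opprB addrC subrK.
Qed.

Lemma vanish_neg x (n : nat) : vanish_above x (-1) ->
  (forall k, (k < n)%N -> x (Negz k) = 0) -> vanish_above x (- n%:Z - 1).
Proof. by move=> x1 xn [i|i] ni; [apply: x1; lia|apply: xn; lia]. Qed.

End vanishing.

(** * Degrees of convergents, by counting polynomials against digit strings *)

Section convergent_degrees.
Variables (F : finFieldType) (alpha : laurent F).
Implicit Types (Q P : {poly F}) (D n k : nat).

Definition approximates Q (k : int) :=
  vanish_above (fracpart (polyL Q * alpha)) k.

(* The degrees of the denominators of the convergents of alpha. *)
Definition convergent_degree D :=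
  forall Q, Q != 0 -> (size Q <= D)%N -> ~ approximates Q (- D%:Z - 1).

(** A finite type parametrizes the polynomials of degree below n, so that they can be counted. *)
Definition poly_of n (f : {ffun 'I_n -> F}) : {poly F} :=
  \poly_(i < n) (if insub i is Some j then f j else 0).

Lemma poly_of_inj n : injective (@poly_of n).
Proof.
move=> f g /polyP fg; apply/ffunP => i; have := fg i.
by rewrite !coef_poly ltn_ord !valK.
Qed.

Lemma size_poly_of n f : (size (@poly_of n f) <= n)%N.
Proof. exact: size_poly. Qed.

Lemma poly_of_onto n Q : (size Q <= n)%N -> exists f, @poly_of n f = Q.
Proof.
move=> Qn; exists [ffun i : 'I_n => Q`_i]; apply/polyP => i.
rewrite coef_poly; case: ifPn => [iltn|]; first by rewrite insubT ffunE.
by rewrite -leqNgt => ni; rewrite nth_default// (leq_trans Qn).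
Qed.

(** [Negz i] is the exponent -(i + 1), so these are the first n digits of the fractional part; the
    polynomial part is ignored. *)
Definition digits n (x : laurent F) : {ffun 'I_n -> F} :=
  [ffun i : 'I_n => x (Negz i)].

Lemma digitsP n (x y : laurent F) :
  digits n x = digits n y <-> forall k, (k < n)%N -> x (Negz k) = y (Negz k).
Proof.
split => [/ffunP xy k kn|xy]; first by have := xy (Ordinal kn); rewrite !ffunE.
by apply/ffunP => i; rewrite !ffunE; exact: xy.
Qed.

Lemma approximatesB Q Q' n :
  digits n (polyL Q * alpha) = digits n (polyL Q' * alpha) ->
  approximates (Q - Q') (- n%:Z - 1).
Proof.
move=> /digitsP QQ'; apply: vanish_neg; first exact: vanish_fracpart_lt1.
by move=> k kn; rewrite fracpart_neg rmorphB mulrBl lcoefB QQ'// subrr.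
Qed.

(** Pigeonhole: q ^ (n + 1) polynomials share only q ^ n strings of n digits, and the difference of
    two that collide is a solution. *)
Lemma dirichlet n :
  exists Q, [/\ Q != 0, (size Q <= n.+1)%N & approximates Q (- n%:Z - 1)].
Proof.
pose h (f : {ffun 'I_n.+1 -> F}) := digits n (polyL (poly_of f) * alpha).
have : ~~ injectiveb h.
  apply/negP => /injectiveP/leq_card; rewrite !card_ffun !card_ord leqNgt.
  move=> /negP; apply.
  by rewrite ltn_exp2l//; exact: card_finNzRing_gt1.
move=> /injectivePn[f [g fg hfg]]; exists (poly_of f - poly_of g); split.
- by rewrite subr_eq0; apply: contra fg => /eqP/poly_of_inj ->.
- by rewrite (leq_trans (size_polyD _ _))// size_polyN geq_max !size_poly_of.
- exact: approximatesB.
Qed.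

(** Polynomials of degree below D are as many as strings of D digits. A collision would contradict
    that D is a convergent degree, so the map is injective, hence bijective. *)
Lemma convergent_degree_onto D (x : laurent F) : convergent_degree D ->
  exists Q, (size Q <= D)%N /\ digits D (polyL Q * alpha) = digits D x.
Proof.
move=> cD; pose h (f : {ffun 'I_D -> F}) := digits D (polyL (poly_of f) * alpha).
have h_inj : injective h.
  move=> f g hfg; apply: contrapT => fg; apply: cD (approximatesB hfg).
    by apply/eqP => /subr0_eq /poly_of_inj.
  by rewrite (leq_trans (size_polyD _ _))// size_polyN geq_max !size_poly_of.
have [g _ hK] := injF_bij h_inj.
by exists (poly_of (g (digits D x))); split; [exact: size_poly_of|exact: hK].
Qed.

(* If Q' is of larger degree than Q then Q' alpha - P' = (Q'/Q) (Q alpha - P),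
   because Q' P - Q P' is a polynomial of norm < 1. *)
Lemma approximates_gap n k :
    (forall D, (n < D <= n + k)%N -> ~ convergent_degree D) ->
  exists Q, [/\ Q != 0, (size Q <= n.+1)%N & approximates Q (- (n + k)%N%:Z - 1)].
Proof.
elim: k => [|k IHk] gap; first by rewrite addn0; exact: dirichlet.
have [|Q [Q0 sQ aQ]] := IHk; first by move=> D Dnk; apply: gap; lia.
have : ~ convergent_degree (n + k.+1) by apply: gap; lia.
rewrite /convergent_degree => /existsNP[Q'].
move=> /not_implyP[Q'0 /not_implyP[sQ' /contrapT aQ']].
have [sQ'n|nsQ'] := leqP (size Q') n.+1; first by exists Q'.
exists Q; split=> //.
have [P vP] := vanish_fracpartP aQ; have [P' vP'] := vanish_fracpartP aQ'.
apply: (@vanish_fracpart _ _ P).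
have eqPP' : Q' * P = Q * P'.
  apply/eqP; rewrite -subr_eq0; apply/eqP/polyL_eq0.
  rewrite rmorphB !rmorphM /=.
  rewrite (_ : _ - _ = polyL Q * (polyL Q' * alpha - polyL P') -
    polyL Q' * (polyL Q * alpha - polyL P)); last by ring.
  apply: vanish_aboveB.
    by apply: vanish_above_le (vanish_aboveM (vanish_polyL sQ) vP'); lia.
  by apply: vanish_above_le (vanish_aboveM (vanish_polyL sQ') vP); lia.
have eqQQ' : polyL Q' * (polyL Q * alpha - polyL P) =
    polyL Q * (polyL Q' * alpha - polyL P').
  by rewrite !mulrBr -!rmorphM eqPP' !rmorphM /=; ring.
apply: (vanish_aboveM_cancel (polyL_lead_neq0 Q'0) (vanish_polyL (leqnn _))).
rewrite eqQQ'.
apply: vanish_above_le (vanish_aboveM (vanish_polyL sQ) vP').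
by rewrite !lerD2r lez_nat ltnW.
Qed.

Lemma convergent_degree0 : convergent_degree 0.
Proof. by move=> Q Q0; rewrite leqn0 size_poly_eq0 (negPf Q0). Qed.

End convergent_degrees.

(** * Norms as powers of q *)

Section norm.
Variables (R : realType) (F : finFieldType).
Local Notation q := (#|F|%:R : R).

Lemma lnorm_is_ldeg (x : laurent F) d : is_ldeg x d -> lnorm R x = q ^ d.
Proof.
move=> [xd xgtd]; rewrite /lnorm; case: eqVneq => [x0|/ldegP[yd ygt]].
  by rewrite x0 eqxx in xd.
congr (_ ^ _); apply/eqP; rewrite eq_le !leNgt.
by apply/andP; split; apply/negP; [move/xgtd/eqP|move/ygt/eqP]; apply/negP.
Qed.

Lemma lnorm_polyL (Q : {poly F}) :
  Q != 0 -> lnorm R (polyL Q) = q ^ ((size Q)%:Z - 1).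
Proof.
move=> Q0; apply: lnorm_is_ldeg; split; first exact: polyL_lead_neq0.
exact: vanish_polyL.
Qed.

Lemma lnorm_polyL_gt0 (Q : {poly F}) : (0 < lnorm R (polyL Q)) = (Q != 0).
Proof.
have [->|Q0] := eqVneq Q 0; first by rewrite rmorph0 lnorm0 ltxx.
by rewrite lnorm_polyL// exprz_gt0// Defs.card_gt0.
Qed.

End norm.

(** * Singularity on average as sparsity of the convergent degrees *)

Section singular_on_average_degrees.
Variables (R : realType) (F : finFieldType) (alpha : laurent F).
Local Notation q := #|F|.

Definition count_convergents n :=
  count (fun D => `[< convergent_degree alpha D >]) (iota 0 n).

Definition sparse_convergents := forall eta : R, 0 < eta ->
  exists n0, forall n, (n0 <= n)%N -> (count_convergents n)%:R <= eta * n%:R.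

Definition count_unsolved (c : R) N :=
  count (fun l => ~~ `[< has_solution c alpha l >]) (iota 1 N).

(** The scales without solution have proportion 1 - Delta / N, so the limit 1 becomes density 0. *)
Lemma singular_on_averageP : singular_on_average R alpha <->
  forall c : R, 0 < c -> forall eta : R, 0 < eta ->
  exists N0, forall N, (N0 <= N)%N -> (count_unsolved c N)%:R <= eta * N%:R.
Proof.
have DeltaE c N : (0 < N)%N ->
    1 - (Delta N c alpha)%:R / N%:R = (count_unsolved c N)%:R / N%:R :> R.
  move=> N0; have : (Delta N c alpha + count_unsolved c N = N)%N.
    by rewrite count_predC size_iota.
  move/(congr1 (fun n => n%:R : R)); rewrite natrD => DN.
  have N0' : N%:R != 0 :> R by rewrite pnatr_eq0 -lt0n.
  by apply: (mulIf N0'); rewrite mulrBl !divfK// mul1r -[X in X - _]DN addrC addKr.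
have norm_quot c N :
    `|(count_unsolved c N)%:R / N%:R| = (count_unsolved c N)%:R / N%:R :> R.
  by rewrite ger0_norm// divr_ge0.
split=> H c c0.
  move=> eta eta0; have /cvgrPdist_le/(_ _ eta0)[N0 _ HN0] := H _ c0.
  exists (maxn N0 1) => N; rewrite geq_max => /andP[N0N N_gt0].
  by have := HN0 _ N0N; rewrite /= DeltaE// norm_quot ler_pdivrMr// ltr0n.
apply/cvgrPdist_le => eta eta0; have [N0 HN0] := H _ c0 _ eta0.
exists (maxn N0 1) => // N /=; rewrite geq_max => /andP[N0N N_gt0].
by rewrite DeltaE// norm_quot ler_pdivrMr ?ltr0n// HN0.
Qed.

Let q_gt1 : (1 < q)%N. Proof. exact: card_finNzRing_gt1. Qed.

Let q_ltn_exp2 : (q <= 2 ^ q)%N. Proof. exact/ltnW/ltn_expl. Qed.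

(** This is the ceiling of D log_2 q, so that 2 ^ l < q ^ D exactly when l < [u D]. *)
Let u D := up_log 2 (q ^ D).

(** As q >= 2, passing from D to D + 1 at least doubles q ^ D and so raises [u] by at least 1. *)
Lemma up_log_card_mono : {mono u : D D' / (D <= D')%N}.
Proof.
apply: leq_mono => D D' DD'; rewrite /u -(up_logMp _ (_ : 0 < q ^ D)%N)//.
  apply: leq_up_log; apply: leq_trans (_ : (q ^ D.+1 <= _)%N).
    by rewrite expnS leq_mul2r q_gt1 orbT.
  by rewrite leq_exp2l.
by rewrite expn_gt0 ltnW.
Qed.

Lemma up_log2_ltn l m : (l < up_log 2 m)%N = (2 ^ l < m)%N.
Proof.
rewrite !ltnNge; congr (~~ _); apply/idP/idP; last exact: up_log_min.
by move=> ml; rewrite (leq_trans (@up_logP 2 m isT))// leq_exp2l.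
Qed.

Lemma up_log_card_gt0 D : (0 < u D)%N = (0 < D)%N.
Proof. by rewrite up_log_gt0 -(ltn_exp2l 0 D q_gt1). Qed.

(** For l = u D - 1, the largest l with 2 ^ l < q ^ D, a solution has degree below D. The constant
    turns 2 ^ l into 2 ^ (u D) >= q ^ D and gains one more factor q, so the fractional part is at
    most q ^ (- D - 1), which a convergent degree excludes. *)
Lemma unsolved_convergent D : (1 < D)%N -> convergent_degree alpha D ->
  ~ has_solution (2 * q%:R : R)^-1 alpha (u D).-1.
Proof.
move=> D1 cD [Q []]; rewrite lnorm_polyL_gt0 => /andP[Q0 Ql] QalphaD.
have uD0 : (0 < u D)%N by rewrite up_log_card_gt0 ltnW.
have luD : (2 ^ (u D).-1 < q ^ D)%N by rewrite -up_log2_ltn -/(u D) prednK.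
have q0 : (0 : R) < q%:R by exact: Defs.card_gt0.
apply: (cD Q) => //.
  move: Ql; rewrite lnorm_polyL// => Ql.
  have : q%:R ^ ((size Q)%:Z - 1) < q%:R ^ D%:Z :> R.
    by apply: le_lt_trans Ql _; rewrite -exprnP -!natrX ltr_nat.
  by rewrite ltr_eXz2l ?card_gt1//; lia.
apply/(@lnorm_le R); apply: le_trans QalphaD _.
rewrite -invfM mulrAC -exprS prednK// (_ : - D%:Z - 1 = - D.+1%:Z); last by lia.
rewrite -invr_expz lef_pV2 ?posrE ?exprz_gt0 ?mulr_gt0 ?exprn_gt0//.
by rewrite -exprnP exprSr ler_pM2r// -!natrX ler_nat up_logP.
Qed.

(** The injective map D -> u D - 1 sends the convergent degrees from 2 to n - 1 to unsolved scales
    at most q n. *)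
Lemma singular_sparse : singular_on_average R alpha -> sparse_convergents.
Proof.
move=> /singular_on_averageP sing eta eta0.
have q0 : (0 : R) < q%:R by exact: Defs.card_gt0.
have c0 : 0 < (2 * q%:R : R)^-1 by rewrite invr_gt0 mulr_gt0.
have eta'0 : 0 < eta / (2 * q%:R) by rewrite divr_gt0// mulr_gt0.
have [N0 HN0] := sing _ c0 _ eta'0.
(* The summand 2 pays for D = 0 and D = 1, for which u D - 1 can be 0, outside the range of
   scales. *)
have le_count n :
      (count_convergents n <= 2 + count_unsolved (2 * q%:R : R)^-1 (q * n))%N.
  case: n => [|[|n]]; rewrite /count_convergents//=; first by case: asboolP.
  rewrite addnA leq_add//; first by do 2 case: asboolP => _.
  rewrite /count_unsolved -!size_filter -[leqLHS](size_map (fun D => (u D).-1)).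
  apply: uniq_leq_size.
    rewrite map_inj_in_uniq ?filter_uniq ?iota_uniq// => D D'.
    rewrite !mem_filter !mem_iota => /andP[_ D2] /andP[_ D'2] /eqP uDD'.
    apply: (incn_inj up_log_card_mono); apply/eqP; move: uDD'; rewrite -eqSS !prednK//.
      by rewrite up_log_card_gt0; lia.
    by rewrite up_log_card_gt0; lia.
  move=> l /mapP[D]; rewrite !mem_filter !mem_iota => /andP[/asboolP cD D2] ->.
  apply/andP; split.
    by apply/negP => /asboolP; apply: unsolved_convergent => //; lia.
  have uD2 : (1 < u D)%N.
    rewrite up_log2_ltn expn1; apply: leq_ltn_trans q_gt1 _.
    by rewrite -{1}(expn1 q) ltn_exp2l//; lia.
  have : (u D <= q * D)%N.
    by apply: up_log_min => //; rewrite expnM leq_exp2r//; lia.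
  have : (q * D <= q * n.+2)%N by rewrite leq_mul2l; apply/orP; right; lia.
  by move: (u D) (q * D)%N (q * n.+2)%N uD2 => a b c; lia.
(* For n >= 4 / eta the constant 2 is at most eta n / 2; the unsolved scales up to q n take the
   other half. *)
have [M HM] : exists M : nat, 4 / eta <= M%:R.
  by exists (Num.truncn (4 / eta)).+1; rewrite ltW// truncnS_gt.
exists (maxn N0 M) => n; rewrite geq_max => /andP[N0n Mn].
apply: le_trans (_ : (2 + count_unsolved (2 * q%:R : R)^-1 (q * n))%:R <= _).
  by rewrite ler_nat.
rewrite natrD (_ : eta * n%:R = eta * n%:R / 2 + eta / (2 * q%:R) * (q * n)%:R); last first.
  by rewrite natrM; field; rewrite gt_eqF.
apply: lerD; last by apply: HN0; rewrite (leq_trans N0n)// leq_pmull// ltnW.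
have : 4 / eta <= n%:R by apply: le_trans HM _; rewrite ler_nat.
by rewrite ler_pdivrMr//; lra.
Qed.

(** An unsolved scale l forces a convergent degree D with u D slightly above l, and each D accounts
    for at most [K] scales. *)
Lemma sparse_singular : sparse_convergents -> singular_on_average R alpha.
Proof.
move=> sparse; apply/singular_on_averageP => c c0 eta eta0.
have q0 : (0 : R) < q%:R by exact: Defs.card_gt0.
have [e qec] : exists e : nat, (q%:R : R)^-1 ^+ e <= c.
  have [e ce] : exists e : nat, c^-1 <= e%:R.
    by exists (Num.truncn c^-1).+1; rewrite ltW// truncnS_gt.
  exists e; rewrite exprVn -[leRHS]invrK lef_pV2 ?posrE ?exprn_gt0 ?invr_gt0//.
  by apply: le_trans ce _; rewrite -natrX ler_nat ltnW// ltn_expl.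
(* As q <= 2 ^ q, multiplying by q ^ e raises the binary logarithm by at most [K]. *)
pose K := (q * e)%N.
have unsolvedP l : ~ has_solution c alpha l ->
    exists D, [/\ convergent_degree alpha D, (D <= l + e)%N &
      (u D - K <= l < u D)%N].
  move=> nsol; pose n := trunc_log q (2 ^ l).
  have nl : (q ^ n <= 2 ^ l)%N by rewrite trunc_logP// expn_gt0.
  have ln : (2 ^ l < q ^ n.+1)%N by exact: trunc_log_ltn.
  have le_nl : (n <= l)%N.
    rewrite -(@leq_exp2l 2)//; apply: leq_trans nl.
    by case: n {ln} => // n; rewrite leq_exp2r.
  (* Otherwise [approximates_gap] gives Q of degree at most n, hence of norm at most 2 ^ l, with
     fractional part at most q ^ (- n - e - 1) <= c / 2 ^ l, because 2 ^ l < q ^ (n + 1). *)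
  have [D Dn cD] : exists2 D, (n < D <= n + e)%N & convergent_degree alpha D.
    apply: contrapT => nD; have [|Q [Q0 sQ aQ]] := @approximates_gap _ alpha n e.
      by move=> D Dn cD; apply: nD; exists D.
    apply: nsol; exists Q; rewrite lnorm_polyL_gt0 Q0/=; split.
      rewrite lnorm_polyL//; apply: le_trans (_ : q%:R ^ n%:Z <= _).
        by rewrite ler_eXz2l ?card_gt1//; lia.
      by rewrite -exprnP -!natrX ler_nat.
    move/(@lnorm_le R) : aQ => /le_trans; apply.
    rewrite (_ : - (n + e)%N%:Z - 1 = - e%:Z + - n.+1%:Z); last by lia.
    rewrite expfzDr ?gt_eqF// -!invr_expz -!exprnP.
    apply: ler_pM; rewrite ?invr_ge0 ?exprn_ge0 -?exprVn//.
    by rewrite !exprVn lef_pV2 ?posrE ?exprn_gt0// -!natrX ler_nat ltnW.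
  exists D; split=> //; first by lia.
  rewrite up_log2_ltn; apply/andP; split; last first.
    by apply: leq_trans ln _; rewrite leq_exp2l//; lia.
  rewrite leq_subLR; apply: up_log_min => //; rewrite expnD mulnC.
  apply: leq_trans (_ : (q ^ n * q ^ e <= _)%N).
    by rewrite -expnD leq_exp2l//; lia.
  rewrite leq_mul// /K expnM; case: (posnP e) => [->//|e0].
  by rewrite leq_exp2r.
have le_count N : (count_unsolved c N <= K * count_convergents (N + e).+1)%N.
  pose Ds := [seq D <- iota 0 (N + e).+1 | `[< convergent_degree alpha D >]].
  pose s := flatten [seq iota (u D - K) K | D <- Ds].
  have -> : (K * count_convergents (N + e).+1 = size s)%N.
    rewrite size_flatten /shape -map_comp -[count_convergents _]size_filter -/Ds.
    rewrite {}/s; elim: Ds => [|D Ds IH] /=; first by rewrite muln0.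
    by rewrite size_iota mulnS IH.
  rewrite /count_unsolved -size_filter; apply: uniq_leq_size.
    by rewrite filter_uniq// iota_uniq.
  move=> l; rewrite mem_filter mem_iota.
  move=> /andP[/asboolPn/unsolvedP[D [cD De uD]] lN].
  apply/flattenP; exists (iota (u D - K) K); last by rewrite mem_iota; lia.
  apply/mapP; exists D => //; rewrite mem_filter mem_iota.
  by apply/andP; split; [exact/asboolP|lia].
(* [K.+1] replaces [K], which is 0 when e = 0. *)
have eta'0 : 0 < eta / (2 * K.+1%:R) by rewrite divr_gt0// mulr_gt0.
have [n0 Hn0] := sparse _ eta'0.
exists (maxn n0 e.+1) => N; rewrite geq_max => /andP[n0N eN].
apply: le_trans (_ : (K.+1 * count_convergents (N + e).+1)%:R <= _).
  by rewrite ler_nat (leq_trans (le_count N))// leq_mul2r leqnSn orbT.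
rewrite natrM.
apply: le_trans (_ : K.+1%:R * (eta / (2 * K.+1%:R) * (N + e).+1%:R) <= _).
  by rewrite ler_pM2l//; apply: Hn0; lia.
rewrite (_ : _ * _ = eta / 2 * (N + e).+1%:R); last by field.
have : (N + e).+1%:R <= 2 * N%:R :> R by rewrite -natrM ler_nat; lia.
by rewrite -(ler_pM2l eta0); lra.
Qed.

End singular_on_average_degrees.

(** * Sets of Hausdorff measure zero *)

Section hausdorff_null.
Variables (R : realType) (T : metricType R).
Implicit Types (A B U : set T) (s delta kappa : R).
Local Open Scope ereal_scope.

Lemma diam_pow_ge0 s U : 0 <= diam_pow s U.
Proof. by rewrite /diam_pow; case: ifP => // _; exact: poweR_ge0. Qed.

Lemma diam_pow0 s : diam_pow s (@set0 T) = 0.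
Proof. by rewrite /diam_pow eqxx. Qed.

Lemma diam_set0 : diam (@set0 T) = -oo.
Proof.
by apply/ereal_sup_ninfty => _ [x []].
Qed.

Lemma diam_le U (d : R) : (forall x y, U x -> U y -> (mdist x y <= d)%R) ->
  diam U <= d%:E.
Proof.
by move=> Ud; apply: ge_ereal_sup => _ [x Ux [y Uy <-]]; rewrite lee_fin; exact: Ud.
Qed.

Lemma diam_ge0 U x : U x -> 0 <= diam U.
Proof.
move=> Ux; apply: ereal_sup_ubound; exists x => //; exists x => //.
by rewrite mdistxx.
Qed.

Lemma diam_pow_le s U (d : R) : (0 <= s)%R -> (0 <= d)%R ->
  diam U <= d%:E -> diam_pow s U <= (d `^ s)%:E.
Proof.
move=> s0 d0 Ud; rewrite /diam_pow; case: eqVneq => [_|/set0P[x Ux]].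
  by rewrite lee_fin powR_ge0.
rewrite -poweR_EFin; apply: gt0_ler_poweR => //; rewrite in_itv/= leey andbT//.
exact: diam_ge0 Ux.
Qed.

Lemma hausdorff_measure_eq0P s A : hausdorff_measure s A = 0 <->
  forall delta kappa, (0 < delta)%R -> (0 < kappa)%R ->
  exists U : (set T)^nat, [/\ A `<=` \bigcup_i U i,
    forall i, diam (U i) <= delta%:E &
    \sum_(0 <= i <oo) diam_pow s (U i) <= kappa%:E].
Proof.
split=> [H0 delta kappa delta0 kappa0|H].
  have : hausdorff_content delta s A < kappa%:E.
    apply: le_lt_trans (_ : 0 < _); last by rewrite lte_fin.
    by rewrite -H0; apply: ereal_sup_ubound; exists delta.
  move=> /ereal_inf_lt[_ [U [AU Udelta] <-] /ltW Ukappa].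
  by exists U.
apply/eqP; rewrite eq_le; apply/andP; split.
  apply: ge_ereal_sup => _ [delta delta0 <-]; apply/lee_addgt0Pr => kappa kappa0.
  have [U [AU Udelta Ukappa]] := H _ _ delta0 kappa0.
  by rewrite add0e; apply: le_trans Ukappa; apply: ereal_inf_lbound; exists U.
apply: le_trans (_ : hausdorff_content 1 s A <= _); last first.
  by apply: ereal_sup_ubound; exists 1%R => /=.
apply: le_ereal_inf_tmp => _ [U _ <-].
by apply: nneseries_ge0 => *; exact: diam_pow_ge0.
Qed.

(** The set of index i gets a cover of cost at most kappa / 2 ^ (pickle i + 1), and the covers are
    merged by enumerating pairs. *)
Lemma hausdorff_measure_bigcup_eq0 (I : countType) s (A : I -> set T) :
  (forall i, hausdorff_measure s (A i) = 0) ->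
  hausdorff_measure s (\bigcup_i A i) = 0.
Proof.
move=> A0; apply/hausdorff_measure_eq0P => delta kappa delta0 kappa0.
have kap i : (0 < kappa / (2 ^ (pickle i).+1)%:R)%R.
  by rewrite divr_gt0// ltr0n expn_gt0.
have /choice[U UP] : forall i, exists U : (set T)^nat, [/\ A i `<=` \bigcup_i U i,
    forall i, diam (U i) <= delta%:E &
    \sum_(0 <= i <oo) diam_pow s (U i) <= (kappa / (2 ^ (@pickle I i).+1)%:R)%:E].
  by move=> i; exact/(hausdorff_measure_eq0P s (A i)).1.
(* A number that encodes no pair is given the empty set, of cost 0. *)
pose V n := if @pickle_inv (I * nat)%type n is Some p then U p.1 p.2 else set0.
exists V; split.
- move=> x [i _ Aix]; have [AU _ _] := UP i; have [j _ Uijx] := AU _ Aix.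
  by exists (pickle (i, j)) => //; rewrite /V pickleK_inv.
- move=> n; rewrite /V; case: pickle_inv => [[i j]|]; first by have [] := UP i.
  by rewrite diam_set0 leNye.
rewrite nneseries_esumT; last by move=> n; exact: diam_pow_ge0.
have -> : \esum_(n in [set: nat]) diam_pow s (V n) =
    \esum_(n in range (@pickle (I * nat)%type)) diam_pow s (V n).
  rewrite [RHS]esum_mkcond; apply: eq_esum => n _; case: ifPn => //.
  rewrite notin_setE /V => nrange; case En: pickle_inv => [p|]; last exact: diam_pow0.
  exfalso; apply: nrange; exists p => //.
  by have := @pickle_invK (I * nat)%type n; rewrite En.
rewrite esum_image; last by move=> p p' _ _; exact: (pcan_inj pickleK).
under eq_esum do rewrite /V pickleK_inv.
have := @esum_esum R I nat setT (fun=> setT) (fun i j => diam_pow s (U i j)).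
rewrite (_ : [set: I] `*`` (fun=> setT) = setT); last by apply/seteqP; split.
move=> <-; last by move=> *; exact: diam_pow_ge0.
apply: le_trans (_ : \esum_(i in [set: I]) (kappa / (2 ^ (pickle i).+1)%:R)%:E <= _).
  apply: le_esum => i _; have [_ _] := UP i.
  by rewrite nneseries_esumT// => n; exact: diam_pow_ge0.
rewrite -(@esum_image _ _ _ setT (@pickle I)
    (fun n => (kappa / (2 ^ n.+1)%:R)%:E)); last first.
  by move=> p p' _ _; exact: (pcan_inj pickleK).
apply: le_trans (epsilon_trick0 xpredT (ltW kappa0)).
rewrite nneseries_esumT; last by move=> n; rewrite lee_fin divr_ge0// ltW.
rewrite esum_mkcond; apply: le_esum => n _; case: ifP => // _.
by rewrite lee_fin divr_ge0// ltW.
Qed.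

Lemma hausdorff_measure_eq0_finite s A :
  (forall delta kappa, (0 < delta)%R -> (0 < kappa)%R ->
    exists n (U : (set T)^nat), [/\ A `<=` \bigcup_(i < n) U i,
      forall i, (i < n)%N -> diam (U i) <= delta%:E &
      \sum_(0 <= i < n) diam_pow s (U i) <= kappa%:E]) ->
  hausdorff_measure s A = 0.
Proof.
move=> H; apply/hausdorff_measure_eq0P => delta kappa delta0 kappa0.
have [n [U [AU Udelta Ukappa]]] := H _ _ delta0 kappa0.
exists (fun i => if (i < n)%N then U i else set0); split.
- by move=> x /AU[i /= ilt Uix]; exists i; rewrite ?ilt.
- by move=> i; case: ifPn => [/Udelta//|_]; rewrite diam_set0 leNye.
rewrite (nneseries_split 0 n); last first.
  by move=> *; exact: diam_pow_ge0.
rewrite [X in _ + X]eseries0 ?adde0; last first.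
  by move=> i + _; rewrite add0n ltnNge => ->; exact: diam_pow0.
apply: le_trans Ukappa; rewrite add0n big_nat [leRHS]big_nat.
by apply: lee_sum => i /andP[_ ->].
Qed.

(** A point has diameter 0, whose power s is 0 for s > 0, but 1 for s = 0. *)
Lemma hausdorff_measure_set1 s (x : T) :
  (0 < s)%R -> hausdorff_measure s [set x] = 0.
Proof.
move=> s0; apply: hausdorff_measure_eq0_finite => delta kappa delta0 kappa0.
have diam1 : diam [set x] <= 0%R%:E.
  by apply: diam_le => _ _ /= -> ->; rewrite mdistxx.
exists 1%N, (fun=> [set x]); split; first by move=> y ->; exists 0%N.
  by move=> _ _; apply: le_trans diam1 _; rewrite lee_fin ltW.
rewrite big_nat1; apply: le_trans (diam_pow_le (ltW s0) (lexx _) diam1) _.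
by rewrite powR0 ?gt_eqF// lee_fin ltW.
Qed.

Lemma hausdorff_measure_subset_eq0 s A B : A `<=` B ->
  hausdorff_measure s B = 0 -> hausdorff_measure s A = 0.
Proof.
move=> AB /hausdorff_measure_eq0P B0; apply/hausdorff_measure_eq0P => d k d0 k0.
have [U [BU Ud Uk]] := B0 _ _ d0 k0; exists U; split=> //.
exact: subset_trans BU.
Qed.

Lemma hausdorff_dim_le s A :
  (0 <= s)%R -> hausdorff_measure s A = 0 -> hausdorff_dim A <= s%:E.
Proof. by move=> s0 HA; apply: ereal_inf_lbound; exists s. Qed.

End hausdorff_null.

(** * Inequalities between powers, for the costs of covers *)

Section real_powers.
Variable R : realType.
Implicit Types x q : R.

Lemma expr_small x (delta : R) : 0 <= x < 1 -> 0 < delta ->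
  exists N, forall n, (N <= n)%N -> x ^+ n <= delta.
Proof.
move=> /andP[x0 x1] delta0.
have /cvgrPdist_le/(_ _ delta0)[N _ HN] : (GRing.exp x : R^nat) @ \oo --> 0.
  by apply: cvg_expr; rewrite ger0_norm.
exists N => n Nn; have := HN _ Nn.
by rewrite sub0r normrN ger0_norm// exprn_ge0.
Qed.

(** This is the total cost in dimension s of q ^ n cylinders of diameter q ^ (- n). *)
Lemma expr_powR_expr q s n :
  0 < q -> q ^+ n * (q^-1 ^+ n) `^ s = (q `^ (1 - s)) ^+ n.
Proof.
move=> q0; have q_ge0 := ltW q0.
rewrite exprVn -!powR_mulrn ?powR_ge0// -powRN -!powRrM -powRD.
  by congr (_ `^ _); ring.
by rewrite (gt_eqF q0) implybT.
Qed.

(** For s = 1 - zeta, logarithms reduce the bound to zeta L ln q <= - ln rho; the minimum with 1/2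
    keeps s positive. *)
Lemma exists_powR_le q rho L : 1 < q -> 0 < rho < 1 -> (0 < L)%N ->
  exists s, [/\ 0 < s, s < 1 & (q `^ (1 - s)) ^+ L * rho <= 1].
Proof.
move=> q1 /andP[rho0 rho1] L0.
have lnq0 : 0 < ln q by rewrite ln_gt0.
have lnrho : 0 < - ln rho by rewrite oppr_gt0 ln_lt0// rho0.
have LR : 0 < L%:R :> R by rewrite ltr0n.
pose zeta := Num.min (1 / 2) (- ln rho / (L%:R * ln q)).
have zeta0 : 0 < zeta by rewrite lt_min divr_gt0// divr_gt0// mulr_gt0.
have zeta2 : zeta <= 1 / 2 by rewrite ge_min lexx.
exists (1 - zeta); split; [lra|lra|].
rewrite subKr -[X in _ * X]lnK ?posrE// /powR gt_eqF ?(lt_trans _ q1)//.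
rewrite -expRM_natl -expRD -[leRHS]expR0 ler_expR.
have : zeta <= - ln rho / (L%:R * ln q) by rewrite ge_min lexx orbT.
rewrite ler_pdivlMr ?mulr_gt0// mulrA [zeta * _]mulrC.
by rewrite mulrAC; lra.
Qed.

End real_powers.

(** * Cylinders of digits and covers by them *)

Section cylinders.
Variables (R : realType) (F : finFieldType).
Implicit Types (x y c : laurent F) (A : set (laurent_metric R F)).
Local Notation q := (#|F|%:R : R).

Definition of_digits_coef (f : nat -> F) (i : int) : F :=
  if i is Negz n then f n else 0.

Lemma of_digits_subproof f :
  exists N : int, forall i, N < i -> of_digits_coef f i = 0.
Proof. by exists 0 => -[]. Qed.

Definition of_digits f : laurent F := Laurent (of_digits_subproof f).

Lemma vanish_of_digits f : vanish_above (of_digits f) (-1).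
Proof. by move=> [i|i] //; lia. Qed.

Lemma lnorm_digits x y n : vanish_above x (-1) -> vanish_above y (-1) ->
  digits n x = digits n y -> lnorm R (x - y) <= q ^ (- n%:Z - 1).
Proof.
move=> x1 y1 /digitsP xy; apply/lnorm_le; apply: vanish_neg.
  exact: vanish_aboveB.
by move=> k kn; rewrite lcoefB xy// subrr.
Qed.

Definition cylinder c n : set (laurent_metric R F) :=
  [set x : laurent F | vanish_above x (-1) /\ digits n x = digits n c].

Lemma diam_cylinder c n : (diam (cylinder c n) <= (q^-1 ^+ n)%:E)%E.
Proof.
apply: diam_le => x y [x1 xc] [y1 yc]; rewrite mdist_lnorm.
apply: le_trans (lnorm_digits x1 y1 (_ : _ = digits n y)) _; first by rewrite xc.
rewrite exprVn exprnP invr_expz ler_eXz2l ?card_gt1//; lia.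
Qed.

(** The bound K on the number of cylinders is real, so that it can carry factors such as 1 - q ^ (-
    e). *)
Definition covered n (K : R) A := exists s : seq (laurent F),
  (size s)%:R <= K /\
  forall x : laurent F, A x -> exists2 c, c \in s & digits n x = digits n c.

Lemma covered_null s A : 0 <= s ->
    (forall x : laurent F, A x -> vanish_above x (-1)) ->
  (forall kappa, 0 < kappa -> forall N, exists n K,
    [/\ (N <= n)%N, covered n K A & K * (q^-1 ^+ n) `^ s <= kappa]) ->
  hausdorff_measure s A = 0%E.
Proof.
move=> s0 A1 Acov; apply: hausdorff_measure_eq0_finite => delta kappa delta0 kappa0.
have q0 : 0 < q by exact: Defs.card_gt0.
have [|N HN] := @expr_small R q^-1 delta _ delta0.
  by rewrite invr_ge0 ltW//= invf_lt1// card_gt1.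
have [n [K [Nn [cs [csK csA]] Kkappa]]] := Acov _ kappa0 N.
exists (size cs), (fun i => cylinder (nth 0 cs i) n); split.
- move=> x Ax; have [c cin xc] := csA _ Ax; exists (index c cs).
    by rewrite /= index_mem.
  by split; [exact: A1|rewrite nth_index].
- by move=> i _; apply: le_trans (diam_cylinder _ _) _; rewrite lee_fin HN.
apply: le_trans (_ : (\sum_(0 <= i < size cs) ((q^-1 ^+ n) `^ s)%:E <= _)%E).
  apply: lee_sum => i _; apply: diam_pow_le s0 _ (diam_cylinder _ _).
  by rewrite exprn_ge0// invr_ge0 ltW.
rewrite sumEFin lee_fin sumr_const_nat subn0 -[leLHS]mulr_natl.
by apply: le_trans Kkappa; rewrite ler_wpM2r// powR_ge0.
Qed.

Lemma covered0 A : covered 0 1 A.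
Proof.
by exists [:: 0]; split=> // x _; exists 0; rewrite ?inE//; apply/digitsP.
Qed.

Definition tail_digits n e x : {ffun 'I_e -> F} :=
  [ffun i : 'I_e => x (Negz (n + i))].

Lemma digitsD n e x y :
  digits (n + e) x = digits (n + e) y <->
  digits n x = digits n y /\ tail_digits n e x = tail_digits n e y.
Proof.
split=> [/digitsP xy|[/digitsP xy /ffunP xye]].
  split; first by apply/digitsP => k kn; apply: xy; rewrite ltn_addr.
  by apply/ffunP => i; rewrite !ffunE xy// ltn_add2l.
apply/digitsP => k kne; have [kn|nk] := ltnP k n; first exact: xy.
have ke : (k - n < e)%N by lia.
by have := xye (Ordinal ke); rewrite !ffunE/= subnKC.
Qed.

(** Among the digits, only those at positions n, ..., n + e - 1 are replaced. For k < n the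
    truncated difference k - n is 0, which [insub] may accept, hence the inner test. *)
Definition extend n e c (t : {ffun 'I_e -> F}) : laurent F :=
  of_digits (fun k => if insub (k - n)%N is Some i then
    if (k < n)%N then c (Negz k) else t i else c (Negz k)).

Lemma extendE n e c t :
  digits n (extend n c t) = digits n c /\ tail_digits n e (extend n c t) = t.
Proof.
split; first by apply/digitsP => k kn /=; rewrite kn; case: insub.
by apply/ffunP => i; rewrite ffunE /= addKn valK ltnNge leq_addr.
Qed.

Lemma covered_extend n e K (b : nat) (B : laurent F -> {set {ffun 'I_e -> F}}) A :
    (forall c, (#|B c| <= b)%N) ->
    (forall x c : laurent F, A x -> digits n x = digits n c ->
      tail_digits n e x \in B c) ->
  covered n K A -> covered (n + e) (K * b%:R) A.
Proof.
move=> Bb AB [s [sK sA]].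
exists [seq extend n c t | c <- s, t <- enum (B c)]; split.
  rewrite size_allpairs_dep; apply: le_trans (_ : (size s * b)%:R <= _).
    rewrite ler_nat; elim: s {sK sA} => //= c s IHs.
    by rewrite mulSn leq_add// -cardE.
  by rewrite natrM ler_wpM2r.
move=> x Ax; have [c cs xc] := sA _ Ax.
have [ec et] := extendE n c (tail_digits n e x).
exists (extend n c (tail_digits n e x)); last by apply/digitsD; rewrite ec et.
by apply/allpairsPdep; exists c, (tail_digits n e x); split=> //; rewrite mem_enum AB.
Qed.

Lemma card_tail e : #|{ffun 'I_e -> F}| = (#|F| ^ e)%N.
Proof. by rewrite card_ffun card_ord. Qed.

Lemma coveredD n e K A : covered n K A -> covered (n + e) (K * q ^+ e) A.
Proof.
rewrite -natrX; apply: (@covered_extend _ _ _ _ (fun=> ~: finset.set0)) => [c|x c _ _].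
  by rewrite finset.setC0 finset.cardsT card_tail.
by rewrite !inE.
Qed.

(** One of the q ^ e subcylinders of each cylinder contains no point of A, and q ^ e - 1 = q ^ e (1
    - q ^ (- e)). *)
Lemma covered_avoid n e K A :
    (forall c, exists y, digits n y = digits n c /\
      forall x : laurent F, A x -> digits (n + e) x <> digits (n + e) y) ->
  covered n K A -> covered (n + e) (K * (q ^+ e * (1 - q^-1 ^+ e))) A.
Proof.
move=> /choice[y yP].
rewrite mulrBr exprVn mulfV ?expf_neq0 ?gt_eqF ?Defs.card_gt0// mulr1.
rewrite -natrX -[X in _ - X]/1%:R -natrB.
  apply: (@covered_extend _ _ _ _ (fun c => ~: finset.set1 (tail_digits n e (y c)))).
    by move=> c; rewrite cardsC1 card_tail subn1.
  move=> x c Ax xc; rewrite !inE; apply/eqP => xy; have [yc Ay] := yP c.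
  by apply: (Ay _ Ax); apply/digitsD; rewrite yc xy.
by rewrite expn_gt0 (ltnW (card_finNzRing_gt1 F)).
Qed.

End cylinders.

(** * Dimension below 1 when the convergents are not sparse *)

Section bad_null.
Variables (R : realType) (F : finFieldType) (alpha : laurent F).
Local Notation q := (#|F|%:R : R).
Implicit Types (m n e j D : nat) (A : set (laurent_metric R F)).

Let q_gt0 : 0 < q. Proof. exact: Defs.card_gt0. Qed.
Let q_gt1 : 1 < q. Proof. exact: card_gt1. Qed.

(* By [convergent_degree_onto], for each such D every cylinder of level D has a
   subcylinder of level D + e without survivors. *)
Definition survivors e m : set (laurent_metric R F) :=
  [set x : laurent F | vanish_above x (-1) /\
    forall D, (m <= D)%N -> convergent_degree alpha D ->
    forall Q : {poly F}, (size Q <= D)%N ->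
      digits (D + e) x <> digits (D + e) (polyL Q * alpha)].

Definition count_convergents_from m n :=
  count (fun D => `[< convergent_degree alpha D >] && (m <= D)%N) (iota 0 n).

Lemma count_convergents_fromS m n : count_convergents_from m n.+1 =
  (count_convergents_from m n + (`[< convergent_degree alpha n >] && (m <= n)))%N.
Proof. by rewrite /count_convergents_from -addn1 iotaD count_cat /= add0n addn0. Qed.

Lemma count_convergents_fromD m n e :
  (count_convergents_from m (n + e) <= count_convergents_from m n + e)%N.
Proof.
elim: e => [|e IHe]; first by rewrite !addn0.
by rewrite !addnS count_convergents_fromS; case: (_ && _); lia.
Qed.

Lemma count_convergents_from_ge m n :
  (count_convergents alpha n <= count_convergents_from m n + m)%N.
Proof.
elim: n => // n IHn; rewrite count_convergents_fromS.
rewrite /count_convergents -addn1 iotaD count_cat.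
rewrite -/(count_convergents alpha n) /= add0n addn0.
have [mn|nm] := leqP m n; first by rewrite andbT; lia.
rewrite andbF addn0 /count_convergents_from.
suff : (count_convergents alpha n <= n)%N by case: asboolP => _; lia.
by rewrite -[leqRHS](size_iota 0 n) count_size.
Qed.

(** The level advances by 1 with every subcylinder kept or, at a convergent degree from m on, jumps
    by e with one subcylinder dropped. A jump passes at most e convergent degrees, so j is at least
    their number divided by e. Jumps may overshoot n, hence the window for n'. *)
Lemma covered_survivors e m : (0 < e)%N -> forall n, exists n' j,
  [/\ (n <= n' <= n + e)%N, (count_convergents_from m n' <= e * j)%N &
      covered n' (q ^+ n' * (1 - q^-1 ^+ e) ^+ j) (survivors e m)].
Proof.
move=> e0; elim=> [|n [n' [j [/andP[nn' n'n] cj cov]]]].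
  by exists 0%N, 0%N; split=> //; rewrite !expr0 mulr1; exact: covered0.
have [n1n'|] := ltnP n n'; first by exists n', j; split=> //; lia.
rewrite leq_eqVlt ltnNge nn' orbF => /eqP n'E; subst n'.
have [/andP[/asboolP cn mn]|ncn] :=
  boolP (`[< convergent_degree alpha n >] && (m <= n)%N).
  exists (n + e)%N, j.+1; split; first by lia.
    rewrite mulnS [(e + e * j)%N]addnC.
    by rewrite (leq_trans (count_convergents_fromD _ _ _))// leq_add2r.
  rewrite exprD exprSr mulrACA; apply: covered_avoid cov => c.
  (* Some Q alpha lies in the cylinder of c, and the survivors avoid its subcylinder of level n +
     e. *)
  have [Q [sQ Qc]] := convergent_degree_onto c cn.
  by exists (polyL Q * alpha); split=> // x [_ /(_ n mn cn Q sQ)].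
exists n.+1, j; split; first by lia.
  by rewrite count_convergents_fromS (negPf ncn) addn0.
by rewrite -addn1 exprD mulrAC; exact: coveredD.
Qed.

(** The first bounds give 2 n <= L j + L m; one copy of n bounds n' up to e, the other absorbs e, N1
    and L m. *)
Lemma jumps_ge e L c n n' m j N N1 : (0 < e)%N -> (2 * e * n <= L * c)%N ->
    (c <= e * j + m)%N -> (n' <= n + e)%N -> (N + N1 + e + L * m <= n)%N ->
  (n' + N1 <= L * j)%N.
Proof.
move=> e0 enc cj n'n Nn.
have : (e * (2 * n) <= e * (L * j + L * m))%N.
  apply: leq_trans (_ : L * (e * j + m) <= _)%N.
    by rewrite mulnA [(e * 2)%N]mulnC (leq_trans enc)// leq_mul2l cj orbT.
  by rewrite !mulnDr mulnCA leq_add2l leq_pmull.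
rewrite leq_pmul2l//; move: (L * j)%N (L * m)%N Nn => a b; lia.
Qed.

(** With tau = q ^ (1 - s), the cover of level n' costs tau ^ n' rho ^ j. Positive upper density
    gives L j >= n' + N1 at suitable scales, so an s with tau ^ L rho <= 1 makes the cost small. The
    same s serves all m, as the union over m requires. *)
Lemma survivors_null e (eta : R) : (0 < e)%N -> 0 < eta ->
    (forall N, exists n, (N <= n)%N /\ eta * n%:R < (count_convergents alpha n)%:R) ->
  exists s, [/\ 0 < s, s < 1 & forall m, hausdorff_measure s (survivors e m) = 0%E].
Proof.
move=> e0 eta0 dense.
have [L Leta] : exists L, 2 * e%:R / eta <= L%:R.
  by exists (Num.truncn (2 * e%:R / eta)).+1; rewrite ltW// truncnS_gt.
have L0 : (0 < L)%N.
  rewrite -(ltr0n R); apply: lt_le_trans Leta.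
  by rewrite divr_gt0// mulr_gt0// ltr0n.
set rho := 1 - q^-1 ^+ e.
have rho01 : 0 < rho < 1.
  rewrite /rho subr_gt0 gtrBl exprn_gt0 ?invr_gt0// andbT.
  by rewrite exprn_ilt1 ?invr_ge0 ?(ltW q_gt0)// ?invf_lt1// -lt0n.
have [s [s0 s1 srho]] := exists_powR_le q_gt1 rho01 L0.
exists s; split=> // m; apply: (@covered_null _ _ s).
- exact: ltW.
- by move=> x [].
move=> kappa kappa0 N; case/andP: rho01 => rho0 rho1.
have [|N1 HN1] := @expr_small R rho (kappa ^+ L) _ (exprn_gt0 _ kappa0).
  by rewrite ltW.
have [n [Nn dn]] := dense (N + N1 + e + L * m)%N.
have [n' [j [/andP[nn' n'n] cj cov]]] := covered_survivors m e0 n.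
exists n', (q ^+ n' * rho ^+ j); split=> //.
  by rewrite (leq_trans _ nn')// (leq_trans _ Nn)// -!addnA leq_addr.
rewrite mulrAC expr_powR_expr//; set tau := q `^ (1 - s) in srho *.
have tau0 : 0 <= tau by exact: powR_ge0.
(* The power L of the cost is (tau ^ L rho) ^ n' rho ^ (L j - n'), hence at most rho ^ (L j - n') <=
   kappa ^ L. *)
rewrite -(@ler_pXn2r _ L)// ?nnegrE ?mulr_ge0 ?exprn_ge0 ?(ltW rho0) ?(ltW kappa0)//.
have jL : (n' + N1 <= L * j)%N.
  apply: (jumps_ge (c := count_convergents alpha n) e0 _ _ n'n Nn).
    rewrite -(ler_nat R) !natrM; move: Leta; rewrite ler_pdivrMr// => Leta.
    apply: le_trans (_ : L%:R * (eta * n%:R) <= _).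
      by rewrite mulrA ler_wpM2r.
    by rewrite ler_pM2l ?ltr0n// ltW.
  apply: leq_trans (count_convergents_from_ge m n) _; rewrite leq_add2r.
  apply: leq_trans cj; rewrite -(subnKC nn') /count_convergents_from iotaD.
  by rewrite count_cat leq_addr.
rewrite exprMn -!exprM [(n' * L)%N]mulnC [(j * L)%N]mulnC exprM.
rewrite -(subnKC (leq_trans (leq_addr _ _) jL)) exprD mulrA -exprMn.
apply: le_trans (_ : 1 * rho ^+ (L * j - n') <= _).
  apply: ler_wpM2r; first by rewrite exprn_ge0// ltW.
  by rewrite exprn_ile1// mulr_ge0 ?exprn_ge0// (ltW rho0).
rewrite mul1r; apply: HN1.
by rewrite leq_subRL// (leq_trans _ jL)// leq_addr.
Qed.

(** If theta shares D + e digits with Q alpha, where deg Q < D, the product in [Bad] is at most q ^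
    (- e - 2), which badness excludes for large Q. The small Q are finitely many, and theta differs
    from each Q alpha at some digit unless it is one of countably many fractional parts. *)
Lemma Bad_subset (eps : R) e : q^-1 ^+ e < eps ->
  Bad eps alpha `<=` \bigcup_(i : (nat + {poly F})%type)
    match i with
    | inl m => survivors e m
    | inr Q => [set fracpart (polyL Q * alpha) : laurent_metric R F]
    end.
Proof.
move=> eeps theta [theta1 thetaBad].
have vtheta : vanish_above theta (-1).
  case: (eqVneq (theta : laurent F) 0) => [->//|t0].
  move: theta1; rewrite /lnorm (negPf t0) -[ltRHS](expr0z q) ltr_eXz2l//.
  by move=> d0; apply: vanish_above_le (ldegP t0).2; lia.
have [M HM] : exists M : R, forall Q, M < lnorm R (polyL Q) ->
    q^-1 ^+ e < lnorm R (polyL Q) * dist_poly R (polyL Q * alpha - theta).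
  have : ((q^-1 ^+ e)%:E < liminf_poly (fun Q =>
      (lnorm R (polyL Q) * dist_poly R (polyL Q * alpha - theta))%:E))%E.
    by apply: lt_le_trans thetaBad; rewrite lte_fin.
  move=> /ereal_sup_gt[_ [M _ <-] HM]; exists M => Q MQ.
  by rewrite -lte_fin; apply: lt_le_trans HM _; apply: ereal_inf_lbound; exists Q.
have [m Hm] : exists m : nat,
    forall Q : {poly F}, (m < size Q)%N -> M < lnorm R (polyL Q).
  exists (Num.truncn M).+2 => Q sQ.
  have Q0 : Q != 0 by rewrite -size_poly_gt0 (leq_ltn_trans _ sQ).
  rewrite lnorm_polyL//; apply: lt_le_trans (truncnS_gt _) _.
  apply: le_trans (_ : q ^ (Num.truncn M).+1%:Z <= _).
    by rewrite -exprnP -natrX ler_nat ltnW// ltn_expl// card_finNzRing_gt1.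
  by rewrite ler_eXz2l//; move: sQ; move: (size Q) => ?; lia.
apply: contrapT => nA.
have /choice[d dP] : forall Q : {poly F}, exists k,
    (theta : laurent F) (Negz k) <> (polyL Q * alpha) (Negz k).
  move=> Q; apply: contrapT => /forallNP thetaQ; apply: nA.
  exists (inr Q) => //=; apply: laurentP => -[i|i]; first by rewrite vtheta//; lia.
  by rewrite fracpart_neg; exact: contrapT (thetaQ i).
(* For every Q of size at most m, [m'] lies past a digit where theta differs from Q alpha. *)
apply: nA; pose m' := (\max_(f : {ffun 'I_m -> F}) (d (poly_of f)).+1)%N.
exists (inl m') => //; split=> // D m'D cD Q sQ thetaQ.
have [sQm|msQ] := leqP (size Q) m.
  have [f fQ] := poly_of_onto sQm.
  apply: (dP Q); move/digitsP : thetaQ; apply.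
  rewrite ltn_addr// (leq_trans _ m'D)// -fQ.
  exact: (@leq_bigmax_cond _ _ (fun f : {ffun 'I_m -> F} => (d (poly_of f)).+1)).
have := HM _ (Hm _ msQ); apply/negP; rewrite -leNgt.
have Q0 : Q != 0 by rewrite -size_poly_gt0 (leq_ltn_trans _ msQ).
have [-> _] := dist_poly_fracpart R (polyL Q * alpha - theta).
rewrite lnorm_polyL// exprVn exprnP invr_expz.
apply: le_trans (_ : q ^ (D%:Z - 1) * q ^ (- (D + e)%N%:Z - 1) <= _); last first.
  by rewrite -expfzDr ?gt_eqF// ler_eXz2l//; lia.
apply: ler_pM; rewrite ?exprz_ge0 ?lnorm_ge0 ?(ltW q_gt0)//.
  by rewrite ler_eXz2l//; move: sQ; move: (size Q) => ?; lia.
apply/lnorm_le; apply: vanish_neg; first exact: vanish_fracpart_lt1.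
move=> k kDe; rewrite fracpart_neg lcoefB.
by move/digitsP : thetaQ => ->; rewrite ?subrr.
Qed.

Lemma Bad_dim_lt1 (eps : R) : 0 < eps -> ~ sparse_convergents R alpha ->
  (hausdorff_dim (Bad eps alpha) < 1)%E.
Proof.
move=> eps0 /existsNP[eta /not_implyP[eta0 /forallNP ndense]].
have [e0 He0] : exists e, forall n, (e <= n)%N -> q^-1 ^+ n <= eps / 2.
  by apply: expr_small; rewrite ?divr_gt0// invr_ge0 (ltW q_gt0) invf_lt1.
have dense N : exists n, (N <= n)%N /\ eta * n%:R < (count_convergents alpha n)%:R.
  have /existsNP[n /not_implyP[Nn /negP]] := ndense N.
  by rewrite -ltNge => ?; exists n.
have [s [s0 s1 surv0]] := survivors_null (ltn0Sn e0) eta0 dense.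
apply: le_lt_trans (_ : s%:E < _)%E; last by rewrite lte_fin.
apply: hausdorff_dim_le; first exact: ltW.
have e0eps : q^-1 ^+ e0.+1 < eps.
  by apply: le_lt_trans (He0 _ (leqnSn _)) _; lra.
apply: hausdorff_measure_subset_eq0 (Bad_subset e0eps) _.
apply: hausdorff_measure_bigcup_eq0 => -[m|Q]; first exact: surv0.
exact: hausdorff_measure_set1.
Qed.

End bad_null.

(** * Prescribed digits avoiding a countable family of cylinders *)

Section avoiding_cylinders.
Variables (R : realType) (F : finFieldType) (S : pred nat) (forced : seq F -> F).
Variables (x : nat -> nat -> F) (l : nat -> nat).
Local Notation q := (#|F|%:R : R).
Implicit Types (w : seq F) (a : F).

Let q_gt0 : 0 < q. Proof. exact: Defs.card_gt0. Qed.

Definition free_count m n := count (predC S) (iota m (n - m)).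

Definition agrees i w :=
  all (fun k => w`_k == x i k) (iota 0 (minn (size w) (l i))).

(* The conditional probability that a random sequence extending w, with uniform
   digits outside S, agrees with x i up to l i: a supermartingale in w whatever
   the digits in S are. *)
Definition hit_prob i w : R :=
  if agrees i w then q^-1 ^+ free_count (size w) (l i) else 0.

Lemma hit_prob_ge0 i w : 0 <= hit_prob i w.
Proof. by rewrite /hit_prob; case: ifP => // _; rewrite exprn_ge0// invr_ge0 ltW. Qed.

Lemma hit_prob_rcons_past i w a :
  (l i <= size w)%N -> hit_prob i (rcons w a) = hit_prob i w.
Proof.
move=> lw; rewrite /hit_prob /free_count size_rcons.
have /eqP -> : (l i - (size w).+1 == 0)%N by rewrite subn_eq0 ltnW.
have /eqP -> : (l i - size w == 0)%N by rewrite subn_eq0.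
rewrite /agrees size_rcons (minn_idPr lw) (minn_idPr (leqW lw)).
congr (if _ then _ else _); apply: eq_in_all => k.
by rewrite mem_iota add0n => /= kl; rewrite nth_rcons (leq_trans kl lw).
Qed.

Lemma hit_prob_rcons i w a : (size w < l i)%N -> hit_prob i (rcons w a) =
  if a == x i (size w) then hit_prob i w * q ^+ ~~ S (size w) else 0.
Proof.
move=> wl; have -> : hit_prob i (rcons w a) =
    if (a == x i (size w)) && agrees i w
    then q^-1 ^+ free_count (size w).+1 (l i) else 0.
  rewrite /hit_prob size_rcons; congr (if _ then _ else _).
  rewrite /agrees size_rcons (minn_idPl wl) (minn_idPl (ltnW wl)).
  rewrite -addn1 iotaD all_cat /= add0n andbT nth_rcons ltnn eqxx andbC.
  congr (_ && _); apply: eq_in_all => k.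
  by rewrite mem_iota add0n => /= kl; rewrite nth_rcons kl.
case: eqP => //= _; rewrite /hit_prob; case: ifP => _; last by rewrite mul0r.
rewrite /free_count -(subnSK wl) /= exprD mulrAC.
by case: (S _); rewrite ?expr0 ?mulr1 ?mul1r// !expr1 mulVf ?mul1r// gt_eqF.
Qed.

Lemma hit_prob_forced i w a : S (size w) -> hit_prob i (rcons w a) <= hit_prob i w.
Proof.
move=> Sw; have [lw|wl] := leqP (l i) (size w).
  by rewrite hit_prob_rcons_past.
rewrite hit_prob_rcons// Sw mulr1; case: ifP => // _; exact: hit_prob_ge0.
Qed.

(** Before level [l i] only the next digit of [x i] contributes, with a gain of q at a free
    position; from that level on the q terms all equal [hit_prob i w]. *)
Lemma hit_prob_sum i w : \sum_a hit_prob i (rcons w a) <= q * hit_prob i w.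
Proof.
have [lw|wl] := leqP (l i) (size w).
  under eq_bigr do rewrite hit_prob_rcons_past//.
  by rewrite sumr_const mulr_natl.
under eq_bigr do rewrite hit_prob_rcons//.
rewrite -big_mkcond big_pred1_eq mulrC ler_wpM2r ?hit_prob_ge0//.
by case: (S _); rewrite ?expr1// expr0 ler1n (ltnW (card_finNzRing_gt1 F)).
Qed.

Definition total_hit w : \bar R := (\sum_(0 <= i <oo) (hit_prob i w)%:E)%E.

(** A digit in S increases no term, by [hit_prob_forced]. At a free position the average of the
    totals over the q choices stays below 1, so some choice works. *)
Lemma total_hit_step w : (total_hit w < 1)%E ->
  exists a, (S (size w) -> a = forced w) /\ (total_hit (rcons w a) < 1)%E.
Proof.
move=> w1; have [Sw|nSw] := boolP (S (size w)).
  exists (forced w); split=> //; apply: le_lt_trans w1.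
  apply: lee_nneseries => [i _ _|i _]; rewrite lee_fin; first exact: hit_prob_ge0.
  exact: hit_prob_forced.
suff [a ha] : exists a, (total_hit (rcons w a) < 1)%E by exists a.
apply: contrapT => /forallNP h1.
have : (q%:E <= \sum_(a : F) total_hit (rcons w a))%E.
  apply: le_trans (_ : (\sum_(a : F) 1 <= _)%E).
    by rewrite sumEFin sumr_const.
  by apply: lee_sum => a _; rewrite leNgt; apply/negP/h1.
apply/negP; rewrite -ltNge /total_hit -nneseries_sum; last first.
  by move=> *; rewrite lee_fin hit_prob_ge0.
apply: le_lt_trans (_ : (\sum_(0 <= i <oo) (q%:E * (hit_prob i w)%:E) < _)%E).
  apply: lee_nneseries => [i _ _|i _].
    by apply: sume_ge0 => a _; rewrite lee_fin hit_prob_ge0.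
  by rewrite sumEFin -EFinM lee_fin hit_prob_sum.
rewrite nneseriesZl; last by move=> i _; rewrite lee_fin hit_prob_ge0.
by rewrite -[ltRHS]mule1 lte_pmul2l// lte_fin.
Qed.

(** Digits are chosen one by one, keeping the total hit probability below 1. Agreeing with [x i] up
    to [l i] would make the term of index i equal to 1. *)
Lemma avoid_cylinders :
    (\sum_(0 <= i <oo) (q^-1 ^+ free_count 0 (l i))%:E < 1)%E ->
  exists f : nat -> F, (forall n, S n -> f n = forced (mkseq f n)) /\
    forall i, exists2 k, (k < l i)%N & f k <> x i k.
Proof.
move=> hit0.
have /choice[next nextP] : forall w, exists a, (total_hit w < 1)%E ->
    (S (size w) -> a = forced w) /\ (total_hit (rcons w a) < 1)%E.
  move=> w; have [/total_hit_step[a ha]|w1] := boolP (total_hit w < 1)%E.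
    by exists a.
  by exists 0.
pose fix b n := if n is n'.+1 then rcons (b n') (next (b n')) else [::].
have size_b n : size (b n) = n by elim: n => //= n IHn; rewrite size_rcons IHn.
have b1 n : (total_hit (b n) < 1)%E.
  elim: n => [|n IHn] /=; last by have [] := nextP _ IHn.
  by rewrite /total_hit; under eq_eseriesr do rewrite /hit_prob /agrees min0n /=.
pose f n := next (b n).
have bE n : b n = mkseq f n.
  by elim: n => //= n IHn; rewrite mkseqS -IHn.
exists f; split=> [n Sn|i].
  by have [h _] := nextP _ (b1 n); rewrite -bE; apply: h; rewrite size_b.
apply: contrapT => nf; have := b1 (l i); apply/negP; rewrite -leNgt.
apply: le_trans (_ : (hit_prob i (b (l i)))%:E <= _)%E; last first.
  rewrite /total_hit (@nneseriesD1 _ _ i)//; last first.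
    by move=> *; rewrite lee_fin hit_prob_ge0.
  by rewrite leeDl// nneseries_ge0// => *; rewrite lee_fin hit_prob_ge0.
rewrite lee_fin /hit_prob ifT; first by rewrite size_b /free_count subnn.
apply/allP => k; rewrite mem_iota add0n size_b minnn => /= kl.
rewrite bE nth_mkseq//; apply/eqP; apply: contrapT => fk.
by apply: nf; exists k.
Qed.

End avoiding_cylinders.

(** * Dimension 1 when the convergents are sparse *)

Section denominators.
Variables (R : realType) (F : finFieldType) (alpha : laurent F).
Local Notation q := (#|F|%:R : R).
Implicit Types (Q P : {poly F}) (D n k : nat).

Lemma approximates_lin Q Q' (c : F) (j : int) :
  approximates alpha Q j -> approximates alpha Q' j ->
  approximates alpha (Q - c *: Q') j.
Proof.
move=> /vanish_fracpartP[P vP] /vanish_fracpartP[P' vP'].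
apply: (@vanish_fracpart _ _ (P - c%:P * P')); rewrite -mul_polyC !rmorphB !rmorphM /=.
rewrite (_ : _ - _ = (polyL Q * alpha - polyL P) -
  polyL c%:P * (polyL Q' * alpha - polyL P')); last by ring.
apply: vanish_aboveB => //; rewrite -[j]add0r; apply: vanish_aboveM vP'.
by have := @vanish_polyL _ _ 1 (size_polyC_leq1 c); rewrite subrr.
Qed.

Definition is_denominator D Q :=
  [/\ Q != 0, (size Q <= D.+1)%N & approximates alpha Q (- D%:Z - 1)].

Definition denominator D : {poly F} := xget 0 [set Q | is_denominator D Q].

Lemma denominatorP D : is_denominator D (denominator D).
Proof. exact: (xgetPex 0 (dirichlet alpha D)). Qed.

Lemma size_denominator D : convergent_degree alpha D -> size (denominator D) = D.+1.
Proof.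
move=> cD; have [Q0 sQ aQ] := denominatorP D.
by apply/eqP; rewrite eqn_leq sQ ltnNge; apply/negP => /(cD _ Q0).
Qed.

(* Denominators of the same convergent degree are proportional. *)
Lemma approximates_denominator D k : convergent_degree alpha D ->
    (forall E, (D < E <= D + k)%N -> ~ convergent_degree alpha E) ->
  approximates alpha (denominator D) (- (D + k)%N%:Z - 1).
Proof.
move=> cD gap; have [Q [Q0 sQ aQ]] := approximates_gap gap.
have aQ' : approximates alpha Q (- D%:Z - 1).
  by apply: vanish_above_le aQ; lia.
have sQD : size Q = D.+1.
  by apply/eqP; rewrite eqn_leq sQ ltnNge; apply/negP => /(cD _ Q0).
have [P0 _ aP] := denominatorP D; have sP := size_denominator cD.
set P := denominator D in P0 aP sP *.
have lQ : Q`_D != 0 by move: Q0; rewrite -lead_coef_eq0 lead_coefE sQD.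
(* The leading terms cancel, so the combination has size at most D; as D is a convergent degree, it
   can only be 0. *)
have := approximates_lin (P`_D / Q`_D) aP aQ'.
have [PQ _|PQ0 /(cD _ PQ0)] := eqVneq (P - (P`_D / Q`_D) *: Q) 0; last first.
  case; apply/leq_sizeP => j Dj; rewrite coefB coefZ.
  have [->|jD] := eqVneq j D; first by rewrite divfK// subrr.
  have Dj' : (D < j)%N by rewrite ltn_neqAle eq_sym jD.
  have [-> ->] : P`_j = 0 /\ Q`_j = 0 by rewrite !(@nth_default _ _ _ j) ?sQD ?sP.
  by rewrite mulr0 subrr.
have : approximates alpha 0 (- (D + k)%N%:Z - 1).
  by rewrite /approximates rmorph0 mul0r => i _ /=; case: ifP.
move=> /(@approximates_lin _ _ (- (P`_D / Q`_D)) _)/(_ aQ).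
by rewrite sub0r scaleNr opprK -(subr0_eq PQ).
Qed.

(* Every digit but one is allowed at position D; we pick an allowed one. *)
Definition forced_digit (w : seq F) : F :=
  if (polyL (denominator (size w)) * of_digits (nth 0 (rcons w 0))) (-1) == 0
  then 1 else 0.

(** The coefficient is affine in the digit [f D], with slope the leading coefficient of the
    denominator, whose degree is exactly D. [forced_digit] evaluates it at the digit 0 and takes 1
    if the value vanishes. *)
Lemma forced_digitP (f : nat -> F) D : convergent_degree alpha D ->
    f D = forced_digit (mkseq f D) ->
  (polyL (denominator D) * of_digits f) (-1) != 0.
Proof.
move=> cD fD; have sP := size_denominator cD.
have [P0 _ _] := denominatorP D; set P := denominator D in sP P0 *.
have vP : vanish_above (polyL P) D%:Z.
  have /vanish_polyL : (size P <= D.+1)%N by rewrite sP.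
  by apply: vanish_above_le; lia.
have lP : polyL P D%:Z != 0.
  have := polyL_lead_neq0 P0; rewrite sP.
  by rewrite (_ : D.+1%:Z - 1 = D%:Z)//; lia.
have vdiff : vanish_above (of_digits f - of_digits (nth 0 (rcons (mkseq f D) 0)))
    (- D%:Z - 1).
  apply: vanish_neg; first by apply: vanish_aboveB; exact: vanish_of_digits.
  by move=> k kD; rewrite lcoefB /= nth_rcons size_mkseq kD nth_mkseq// subrr.
have top : (of_digits f - of_digits (nth 0 (rcons (mkseq f D) 0))) (Negz D) = f D.
  by rewrite lcoefB /= nth_rcons size_mkseq ltnn eqxx subr0.
have := lcoefM_top vP vdiff.
rewrite (_ : D%:Z + (- D%:Z - 1) = -1); last by lia.
rewrite (_ : - D%:Z - 1 = Negz D); last by lia.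
rewrite top mulrBr lcoefB fD /forced_digit size_mkseq -/P.
case: ifPn => [/eqP ->|ne0 /eqP]; first by rewrite subr0 mulr1 => ->.
by rewrite mulr0 subr_eq0 => /eqP ->.
Qed.

(** For D the largest convergent degree at most deg Q + 1, [approximates_denominator] puts T alpha
    within q ^ (- deg Q - 2) of a polynomial P, T being the denominator of degree D. This forces the
    fractional part x of Q alpha - theta to have norm at least q ^ (- D - 1), while Q has norm at
    least q ^ (D - 1). *)
Lemma Bad_of_digits (f : nat -> F) :
    (forall D, convergent_degree alpha D ->
      (polyL (denominator D) * of_digits f) (-1) != 0) ->
  Bad (q^-1 ^+ 3) alpha (of_digits f).
Proof.
move=> fP; have q0 : 0 < q by exact: Defs.card_gt0.
set theta := of_digits f; split.
  apply: le_lt_trans (_ : q ^ (-1 : int) < 1).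
    by apply/lnorm_le; exact: vanish_of_digits.
  by rewrite -[ltRHS](expr0z q) ltr_eXz2l ?card_gt1.
suff BadQ Q : Q != 0 ->
    q^-1 ^+ 3 <= lnorm R (polyL Q) * dist_poly R (polyL Q * alpha - theta).
  apply: le_trans (ereal_sup_ubound _); last by exists 0.
  apply: le_ereal_inf_tmp => _ [Q /= + <-]; rewrite lnorm_polyL_gt0 => Q0.
  by rewrite lee_fin BadQ.
move=> Q0.
have exD : exists D, `[< convergent_degree alpha D >] && (D <= size Q)%N.
  by exists 0%N; rewrite andbT; apply/asboolP; exact: convergent_degree0.
have leD D : `[< convergent_degree alpha D >] && (D <= size Q)%N -> (D <= size Q)%N.
  by case/andP.
case: (ex_maxnP exD leD) => D /andP[/asboolP cD Dm] Dmax.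
have gap E : (D < E <= D + (size Q - D))%N -> ~ convergent_degree alpha E.
  rewrite subnKC// => /andP[DE EQ] /asboolP cE.
  by have := Dmax E; rewrite cE EQ => /(_ isT); rewrite leqNgt DE.
have := approximates_denominator cD gap; rewrite subnKC//.
move=> /vanish_fracpartP[P vP].
have [B xB] := fracpartB (polyL Q * alpha - theta).
have [-> _] := dist_poly_fracpart R (polyL Q * alpha - theta).
set x := fracpart _ in xB *; set T := denominator D in vP.
have sT : (size T <= D.+1)%N by have [] := denominatorP D.
apply: le_trans (_ : q ^ (D%:Z - 2) * q ^ (- D%:Z - 1) <= _).
  rewrite -expfzDr ?gt_eqF// exprVn exprnP invr_expz ler_eXz2l ?card_gt1//; lia.
apply: ler_pM; rewrite ?exprz_ge0 ?(ltW q0)//.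
  by rewrite lnorm_polyL// ler_eXz2l ?card_gt1//; move: Dm; move: (size Q) => ?; lia.
rewrite leNgt; apply/negP => xlt.
have vx : vanish_above x (- D%:Z - 2).
  have [->//|/ldegP xd] := eqVneq x 0.
  move: xlt; rewrite (lnorm_is_ldeg R xd) ltr_eXz2l ?card_gt1// => xlt.
  by apply: vanish_above_le xd.2; lia.
have /eqP := fP _ cD; apply; rewrite -/T.
(* Up to a polynomial, which has no term in z ^ -1, T theta is a difference of two series of degree
   at most -2. *)
have -> : polyL T * theta = polyL (Q * P - T * B) +
    (polyL Q * (polyL T * alpha - polyL P) - polyL T * x).
  rewrite rmorphB !rmorphM /= -xB; ring.
rewrite lcoefD polyL_neg add0r.
have vQ := vanish_aboveM (vanish_polyL (leqnn (size Q))) vP.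
have vT := vanish_aboveM (vanish_polyL sT) vx.
by rewrite lcoefB vQ ?vT ?subrr//; lia.
Qed.

(** The error kappa serves empty sets and sets of diameter 0, which fit in cylinders of any level.
    Otherwise n is least with q ^ (- n - 2) < d, for d the diameter: d <= q ^ (- n - 1) puts U in a
    cylinder of level n, and q ^ (- n) < q ^ 2 d bounds its cost. *)
Lemma cylinder_of_diam (t s kappa : R) (U : set (laurent_metric R F)) :
    0 <= s -> s <= t -> 0 < t -> t <= 1 -> 0 < kappa ->
    (diam U <= (q^-1)%:E)%E ->
  exists (c : nat -> F) n, (forall x : laurent F, U x -> forall k, (k < n)%N ->
      x (Negz k) = c k) /\
    (((q^-1 ^+ n) `^ t)%:E <= (q ^+ 2)%:E * diam_pow s U + kappa%:E)%E.
Proof.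
move=> s0 st t0 t1 kappa0 Uq.
have q0 : 0 < q by exact: Defs.card_gt0.
have q1 : 1 < q by exact: card_gt1.
have qV : 0 <= q^-1 < 1 by rewrite invr_ge0 ltW//= invf_lt1.
have small : exists n, (((q^-1 ^+ n) `^ t)%:E <= kappa%:E)%E.
  have [|n Hn] := @expr_small R q^-1 (kappa `^ t^-1) qV; first by rewrite powR_gt0.
  exists n; rewrite lee_fin.
  apply: le_trans (_ : (kappa `^ t^-1) `^ t <= _).
    apply: ge0_ler_powR;
      rewrite ?nnegrE ?powR_ge0 ?exprn_ge0 ?invr_ge0 ?(ltW t0) ?(ltW q0)//.
    exact: Hn.
  by rewrite -powRrM mulVf ?gt_eqF// powRr1// ltW.
have q2 : (0 <= (q ^+ 2)%:E * diam_pow s U)%E.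
  by rewrite mule_ge0 ?diam_pow_ge0// lee_fin exprn_ge0// ltW.
have [U0|/set0P[c Uc]] := eqVneq U set0.
  have [n Hn] := small; exists (fun=> 0), n; split; first by rewrite U0.
  by rewrite (le_trans Hn)// leeDr.
exists (fun k => (c : laurent F) (Negz k)).
have d0 := diam_ge0 Uc.
have Ud (x : laurent F) : U x -> ((lnorm R (x - c))%:E <= diam U)%E.
  by move=> Ux; apply: ereal_sup_ubound; exists x => //; exists c.
have : diam U \is a fin_num.
  by rewrite ge0_fin_numE// (le_lt_trans Uq)// ltry.
move=> /fineK; move: (fine _) => d dE.
rewrite -dE !lee_fin in d0 Uq Ud.
have {}Ud (x : laurent F) : U x -> lnorm R (x - c) <= d.
  by move=> /Ud; rewrite lee_fin.
move: d0; rewrite le_eqVlt => /orP[/eqP d0|d0].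
  have [n Hn] := small; exists n; split; last by rewrite (le_trans Hn)// leeDr.
  move=> x /Ud; rewrite -d0 => xc k _.
  suff /subr0_eq -> : x - c = 0 by [].
  by apply: (@lnorm_eq0 R); apply/eqP; rewrite eq_le xc lnorm_ge0.
have exn : exists n, q^-1 ^+ n.+2 < d.
  have [|n Hn] := @expr_small R q^-1 (d / 2) qV; first by rewrite divr_gt0.
  exists n; apply: le_lt_trans (Hn n.+2 _) _; first by rewrite ltnW.
  by lra.
case: (ex_minnP exn) => n nd nmin; exists n; split.
  move=> x /Ud xc k kn; apply/eqP; rewrite -subr_eq0 -lcoefB; apply/eqP.
  suff /lnorm_le : lnorm R (x - c) <= q ^ (- n.+1%:Z).
    by apply; rewrite NegzE ltrN2 ltz_nat ltnS.
  apply: le_trans xc _; rewrite -invr_expz -exprnP -exprVn.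
  (* For n = 0 minimality says nothing, and the bound on d is the hypothesis [Uq]. *)
  case: n {nd kn} nmin => [|n] nmin; first by rewrite expr1.
  by rewrite leNgt; apply/negP => /nmin; rewrite ltnn.
apply: le_trans (_ : (q ^+ 2)%:E * diam_pow s U <= _)%E; last first.
  by rewrite leeDl// lee_fin ltW.
rewrite /diam_pow ifF; last by apply/negbTE/set0P; exists c.
rewrite -dE poweR_EFin -EFinM lee_fin.
apply: le_trans (_ : (q ^+ 2 * d) `^ t <= _).
  rewrite ge0_ler_powR ?nnegrE ?mulr_ge0 ?exprn_ge0 ?(ltW t0) ?(ltW d0)
    ?(ltW q0) ?invr_ge0 ?(ltW q0)//.
  have := ltW nd; rewrite -addn2 exprD exprVn [_ ^+ 2]exprVn.
  by rewrite ler_pdivrMr ?exprn_gt0// mulrC.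
rewrite powRM ?exprn_ge0 ?(ltW q0) ?(ltW d0)//.
apply: ler_pM; rewrite ?powR_ge0//.
  rewrite -[leRHS]powRr1 ?exprn_ge0 ?(ltW q0)//.
  by rewrite ler_powR// exprn_ege1// ltW.
apply: ger_powR => //; rewrite d0/=; apply: le_trans Uq _.
by rewrite invf_le1// ltW.
Qed.

Lemma free_count_convergents n :
  free_count (fun D => `[< convergent_degree alpha D >]) 0 n =
  (n - count_convergents alpha n)%N.
Proof.
have := count_predC (fun D => `[< convergent_degree alpha D >]) (iota 0 n).
by rewrite size_iota /free_count subn0 => {2}<-; rewrite addKn.
Qed.

(** This is a mass distribution argument: for t between s and 1, sparsity bounds the mass of a
    cylinder of level n by a constant times q ^ (- t n). A cover that is cheap in dimension s
    becomes a family of cylinders of total mass below 1, and some bad point avoids them all. *)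
Lemma Bad_measure_neq0 (s : R) : sparse_convergents R alpha ->
  0 <= s -> s < 1 -> hausdorff_measure s (Bad (q^-1 ^+ 3) alpha) <> 0%E.
Proof.
move=> sparse s0 s1 /hausdorff_measure_eq0P H.
have q0 : 0 < q by exact: Defs.card_gt0.
have q1 : 1 < q by exact: card_gt1.
pose t := (s + 1) / 2.
have [t0 t1 st] : [/\ 0 < t, t < 1 & s <= t] by rewrite /t; split; lra.
have [|n0 Hn0] := sparse (1 - t); first by rewrite subr_gt0.
(* For n >= n0 at least t n of the first n digits are free; the factor q ^ n0 takes care of smaller
   n. *)
have mass n : q^-1 ^+ free_count (fun D => `[< convergent_degree alpha D >]) 0 n <=
    q ^+ n0 * (q^-1 ^+ n) `^ t.
  rewrite free_count_convergents.
  have cn : (count_convergents alpha n <= n)%N.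
    by rewrite -[leqRHS](size_iota 0 n) count_size.
  have le : t * n%:R <= n0%:R + (n - count_convergents alpha n)%:R.
    rewrite natrB//; have [n0n|nn0] := leqP n0 n.
      have := Hn0 _ n0n; have : 0 <= n0%:R :> R by []. lra.
    have : n%:R <= n0%:R :> R by rewrite ler_nat ltnW.
    have : (count_convergents alpha n)%:R <= n%:R :> R by rewrite ler_nat.
    have : t * n%:R <= n%:R by rewrite ler_piMl// ltW.
    by lra.
  rewrite !exprVn -!powR_mulrn ?(ltW q0)// -!powRN -powRrM -powRD; last first.
    by rewrite (gt_eqF q0) implybT.
  by rewrite ler_powR ?(ltW q1)//; move: le; rewrite mulNr [t * _]mulrC; lra.
pose C := q ^+ n0; have C0 : 0 < C by rewrite exprn_gt0.
(* This choice bounds the total mass by C (q ^ 2 kappa + kappa) = 1/2. *)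
pose kappa := (2 * C * (q ^+ 2 + 1))^-1.
have kappa0 : 0 < kappa by rewrite invr_gt0 !mulr_gt0// addr_gt0// exprn_gt0.
have qV0 : 0 < q^-1 by rewrite invr_gt0.
have [U [BadU Uq Ukappa]] := H _ _ qV0 kappa0.
have /choice[c /choice[l cl]] : forall i, exists (c : nat -> F) n,
    (forall x : laurent F, U i x -> forall k, (k < n)%N -> x (Negz k) = c k) /\
    (((q^-1 ^+ n) `^ t)%:E <=
      (q ^+ 2)%:E * diam_pow s (U i) + (kappa / (2 ^ i.+1)%:R)%:E)%E.
  move=> i; apply: cylinder_of_diam => //; first exact: ltW.
  by rewrite divr_gt0// ltr0n expn_gt0.
have [|f [fS favoid]] := @avoid_cylinders R F
    (fun D => `[< convergent_degree alpha D >]) forced_digit c l.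
  apply: le_lt_trans (_ : C%:E * ((q ^+ 2)%:E * kappa%:E + kappa%:E) < _)%E; last first.
    rewrite -(EFinM (q ^+ 2) kappa) -(EFinD (q ^+ 2 * kappa)) -EFinM lte_fin.
    rewrite (_ : _ * _ = 2^-1); first by lra.
    by rewrite /kappa; field; rewrite !gt_eqF// addr_gt0// exprn_gt0.
  apply: le_trans (_ : \sum_(0 <= i <oo) C%:E *
      ((q ^+ 2)%:E * diam_pow s (U i) + (kappa / (2 ^ i.+1)%:R)%:E) <= _)%E.
    apply: lee_nneseries => [i _ _|i _].
      by rewrite lee_fin exprn_ge0// invr_ge0 ltW.
    apply: le_trans (_ : (C * (q^-1 ^+ l i) `^ t)%:E <= _)%E.
      by rewrite lee_fin mass.
    by rewrite EFinM lee_pmul2l// ?lte_fin//; have [] := cl i.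
  have q2 i : (0 <= (q ^+ 2)%:E * diam_pow s (U i))%E.
    by rewrite mule_ge0 ?diam_pow_ge0// lee_fin exprn_ge0// ltW.
  rewrite nneseriesZl; last first.
    by move=> i _; rewrite adde_ge0// lee_fin divr_ge0// ltW.
  rewrite lee_pmul2l ?lte_fin//.
  apply: le_trans (epsilon_trick xpredT q2 (ltW kappa0)) _.
  rewrite leeD2r// nneseriesZl; last by move=> i _; exact: diam_pow_ge0.
  by rewrite lee_pmul2l ?lte_fin ?exprn_gt0.
have fBad : Bad (q^-1 ^+ 3) alpha (of_digits f).
  apply: Bad_of_digits => D cD; apply: forced_digitP => //.
  by apply: fS; exact/asboolP.
have [i _ Uif] := BadU _ fBad; have [k kl] := favoid i; apply.
by have [/(_ _ Uif _ kl)] := cl i.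
Qed.

(** For d > 0, the q ^ n cylinders of level n cover the unit ball at cost at most q ^ (- d n) in
    dimension 1 + d. *)
Lemma Bad_dim_le1 (eps : R) : (hausdorff_dim (Bad eps alpha) <= 1)%E.
Proof.
have q0 : 0 < q by exact: Defs.card_gt0.
have q1 : 1 < q by exact: card_gt1.
apply/lee_addgt0Pr => d d0; rewrite -EFinD.
apply: hausdorff_dim_le; first by rewrite addr_ge0// ltW.
apply: (@covered_null _ _ (1 + d)); first by rewrite addr_ge0// ltW.
  move=> x [x1 _]; have [->//|/ldegP xd] := eqVneq (x : laurent F) 0.
  move: x1; rewrite (lnorm_is_ldeg R xd) -[ltRHS](expr0z q) ltr_eXz2l//.
  by move=> ?; apply: vanish_above_le xd.2; lia.
move=> kappa kappa0 N.
have [|N1 HN1] := @expr_small R (q `^ (1 - (1 + d))) kappa _ kappa0.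
  rewrite powR_ge0/= (_ : 1 - (1 + d) = - d); last by ring.
  rewrite powRN invf_lt1 ?powR_gt0//.
  by have := gt0_ltr_powR d0 _ _ q1; rewrite powR1 !nnegrE ler01 (ltW q0); apply.
exists (N + N1)%N, (1 * q ^+ (N + N1)); split; first by lia.
  by rewrite -{1}[(N + N1)%N]add0n; apply: coveredD; exact: covered0.
by rewrite mul1r expr_powR_expr// HN1//; lia.
Qed.

Lemma sparse_Bad_dim1 : sparse_convergents R alpha ->
  hausdorff_dim (Bad (q^-1 ^+ 3) alpha) = 1%E.
Proof.
move=> sparse; apply/eqP; rewrite eq_le Bad_dim_le1/=.
apply: le_ereal_inf_tmp => _ [s [s0 Hs] <-]; rewrite lee_fin leNgt.
by apply/negP => s1; exact: (Bad_measure_neq0 sparse s0 s1).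
Qed.

End denominators.

Theorem theorem2p2 (R : realType) (F : finFieldType) (alpha : laurent F)
    (irr_alpha : irrational_laurent alpha) :
  (exists eps : R, 0 < eps /\ hausdorff_dim (Bad eps alpha) = 1%E) <->
  singular_on_average R alpha.
Proof.
split=> [[eps [eps0 dim1]]|/singular_sparse sparse].
  apply: sparse_singular; apply: contrapT => nsparse.
  by have := Bad_dim_lt1 eps0 nsparse; rewrite dim1 ltxx.
exists (#|F|%:R^-1 ^+ 3); split; last exact: sparse_Bad_dim1.
by rewrite exprn_gt0// invr_gt0 Defs.card_gt0.
Qed.
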